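(* Let $G=B*_A C$ be an amalgamated free product, where $A,B,C$ are finitely generated groups. Let $M$ be a submonoid of $G$ such that both $M\cap B$ and $M\cap C$ are finitely generated monoids and $M$ is generated, as a monoid, by $(M\cap B)\cup(M\cap C)$. Assume further that the following conditions hold: (i) $B$ and $C$ have decidable rational subset membership problem; (ii) $A\leq B$ is effectively closed for rational intersections; (iii) $A\leq C$ is effectively closed for rational intersections. Then the membership problem for $M$ in $G$ is decidable.
   Context: $B*_A C$ denotes the free product of groups $B$ and $C$ amalgamated over $A$ with respect to injective homomorphisms $f:A\to B$ and $g:A\to C$; the groups $A,B,C$ are identified with their images in $G=B*_AC$, so that $B\cap C=A$. All groups come with fixed finite generating sets ($G$ is generated by the union of those of $B$ and $C$), and $f,g$ are given by fixed words for the images of the generators of $A$. For a set $\Omega$ write $\overline{\Omega}=\Omega\cup\Omega^{-1}$. Let $K$ be a group with finite generating set $\Omega$ and canonical homomorphism $\tau:\overline{\Omega}^*\to K$. - The rational subsets $\mathrm{Rat}(K)$ form the smallest class of subsets of $K$ containing all finite subsets and closed under union, product and submonoid generation; equivalently, they are the sets $L(\mathcal A)\tau$, where $L(\mathcal A)$ is the language of a finite state automaton (FSA) $\mathcal A$ over $\overline{\Omega}$. - $K$ has decidable rational subset membership problem if there is an algorithm which, given an FSA $\mathcal A$ over $\overline{\Omega}$ and a word $w\in\overline{\Omega}^*$, decides whether $w\tau\in L(\mathcal A)\tau$. - A finitely generated subgroup $H\le K$ is effectively closed for rational intersections if $R\cap H\in \mathrm{Rat}(K)$ for all $R\in\mathrm{Rat}(K)$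 and, moreover, there is an algorithm which, given an FSA $\mathcal A$ over $\overline{\Omega}$, computes an FSA $\mathcal A_H$ over $\overline{\Omega}$ such that $L(\mathcal A_H)\tau=(L(\mathcal A)\tau)\cap H$. - For a finitely generated submonoid $N$ of $K$, the membership problem for $N$ in $K$ is decidable if there is an algorithm which, given any word $w\in\overline{\Omega}^*$, decides whether $w\tau\in N$. *)

(* Defs.v *)
From HB Require Import structures.
From mathcomp Require Import all_boot.
From mathcomp Require Import boolp classical_sets cardinality.

Set Implicit Arguments.
Unset Strict Implicit.
Unset Printing Implicit Defensive.

Local Open Scope classical_set_scope.

(* Algorithms.  The model of computation is the one-variable fragment of the
   WHILE language of N. D. Jones ("Computability and Complexity from a
   Programming Perspective", where the fragment is called I), which is Turing
   complete.  The data are binary trees, and a program transforms the content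
   of its unique variable.  Jones's "hd" and "tl" of the empty tree are empty,
   and the empty tree is the only datum counting as false. *)

Inductive data := Leaf | Node of data & data.

Inductive expr :=
  | Var | ENil | ECons of expr & expr | EHd of expr | ETl of expr.

Inductive prog :=
  | Assign of expr | Seq of prog & prog | While of expr & prog.

Fixpoint eval (e : expr) (x : data) : data :=
  match e with
  | Var => x
  | ENil => Leaf
  | ECons e1 e2 => Node (eval e1 x) (eval e2 x)
  | EHd e1 => if eval e1 x is Node l _ then l else Leaf
  | ETl e1 => if eval e1 x is Node _ r then r else Leaf
  end.

(* [exec p x y]: started with x in the variable, p terminates with y in it. *)
Inductive exec : prog -> data -> data -> Prop :=
  | exec_assign e x : exec (Assign e) x (eval e x)
  | exec_seq p q x y z : exec p x y -> exec q y z -> exec (Seq p q) x z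
  | exec_while_stop e p x : eval e x = Leaf -> exec (While e p) x x
  | exec_while_step e p x y z : eval e x <> Leaf ->
      exec p x y -> exec (While e p) y z -> exec (While e p) x z.

Definition enc_bool (b : bool) : data := if b then Node Leaf Leaf else Leaf.
Definition enc_nat (n : nat) : data := iter n (Node Leaf) Leaf.
Definition enc_pair (X Y : Type) (eX : X -> data) (eY : Y -> data)
  (u : X * Y) : data := Node (eX u.1) (eY u.2).
Definition enc_seq (X : Type) (eX : X -> data) (s : seq X) : data :=
  foldr (fun x d => Node (eX x) d) Leaf s.

Definition decidable_problem (X : Type) (eX : X -> data) (P : X -> Prop) : Prop :=
  exists p : prog, forall x : X, exec p (eX x) (enc_bool `[< P x >]).

(* Words over a symmetric alphabet: the letter (i, false) stands for the i-th
   generator and (i, true) for its inverse. *)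

Definition letter (k : nat) : Type := ('I_k * bool)%type.
Definition word (k : nat) : Type := seq (letter k).

Definition enc_letter (k : nat) : letter k -> data :=
  enc_pair (fun i : 'I_k => enc_nat i) enc_bool.
Definition enc_word (k : nat) : word k -> data := enc_seq (@enc_letter k).

Definition letter_val (K : groupType) (k : nat) (g : 'I_k -> K)
  (l : letter k) : K := (if l.2 then (g l.1)^-1 else g l.1)%g.
Definition word_val (K : groupType) (k : nat) (g : 'I_k -> K)
  (w : word k) : K := (\prod_(l <- w) letter_val g l)%g.

Definition generates (K : groupType) (k : nat) (g : 'I_k -> K) : Prop :=
  forall x : K, exists w : word k, word_val g w = x.

(* Nondeterministic automata: states are natural numbers, and
   (p, l, q) \in fsa_trans A is an edge from p to q labelled l. *)

Record fsa (k : nat) := FSA {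
  fsa_init : seq nat;
  fsa_final : seq nat;
  fsa_trans : seq (nat * letter k * nat)
}.

Fixpoint fsa_path (k : nat) (A : fsa k) (p : nat) (w : word k) (q : nat) : Prop :=
  if w is l :: w' then
    exists2 r : nat, (p, l, r) \in fsa_trans A & fsa_path A r w' q
  else p = q.

Definition fsa_lang (k : nat) (A : fsa k) : set (word k) :=
  [set w | exists p q : nat,
     [/\ p \in fsa_init A, q \in fsa_final A & fsa_path A p w q]].

Definition fsa_set (K : groupType) (k : nat) (g : 'I_k -> K) (A : fsa k) : set K :=
  word_val g @` fsa_lang A.

Definition enc_fsa (k : nat) (A : fsa k) : data :=
  Node (enc_seq enc_nat (fsa_init A))
    (Node (enc_seq enc_nat (fsa_final A))
      (enc_seq (enc_pair (enc_pair enc_nat (@enc_letter k)) enc_nat)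
         (fsa_trans A))).

Definition is_submonoid (K : groupType) (M : set K) : Prop :=
  M 1%g /\ forall x y : K, M x -> M y -> M (x * y)%g.

Definition submonoid_gen (K : groupType) (X : set K) : set K :=
  smallest (@is_submonoid K) X.

Definition fg_monoid (K : groupType) (M : set K) : Prop :=
  exists X : set K, finite_set X /\ M = submonoid_gen X.

Inductive rational (K : groupType) : set K -> Prop :=
  | rational_finite X : finite_set X -> rational X
  | rational_union X Y : rational X -> rational Y -> rational (X `|` Y)
  | rational_prod X Y : rational X -> rational Y ->
      rational [set (x * y)%g | x in X & y in Y]
  | rational_star X : rational X -> rational (submonoid_gen X).

Definition decidable_rational_membership
    (K : groupType) (k : nat) (g : 'I_k -> K) : Prop :=
  decidable_problem (enc_pair (@enc_fsa k) (@enc_word k))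
    (fun u => fsa_set g u.1 (word_val g u.2)).

Definition effectively_closed_rational
    (K : groupType) (k : nat) (g : 'I_k -> K) (H : set K) : Prop :=
  (forall R : set K, rational R -> rational (R `&` H)) /\
  (exists p : prog, forall A : fsa k, exists AH : fsa k,
     exec p (enc_fsa A) (enc_fsa AH) /\ fsa_set g AH = fsa_set g A `&` H).

Definition decidable_membership
    (K : groupType) (k : nat) (g : 'I_k -> K) (N : set K) : Prop :=
  decidable_problem (@enc_word k) (fun w => N (word_val g w)).

(* G, with the maps iB and iC, is the pushout of f and g in the category of
   groups; for injective f and g it is the amalgamated free product B *_A C. *)
Definition is_pushout (A B C G : groupType)
    (f : {multiplicative A -> B}) (g : {multiplicative A -> C})
    (iB : {multiplicative B -> G}) (iC : {multiplicative C -> G}) : Prop :=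
  (forall x : A, iB (f x) = iC (g x)) /\
  (forall (H : groupType)
      (phi : {multiplicative B -> H}) (psi : {multiplicative C -> H}),
    (forall x : A, phi (f x) = psi (g x)) ->
    exists theta : {multiplicative G -> H},
      [/\ forall y : B, theta (iB y) = phi y,
          forall z : C, theta (iC z) = psi z
        & forall theta' : {multiplicative G -> H},
            (forall y : B, theta' (iB y) = phi y) ->
            (forall z : C, theta' (iC z) = psi z) -> theta' =1 theta]).

Definition is_amalgam (A B C G : groupType)
    (f : {multiplicative A -> B}) (g : {multiplicative A -> C})
    (iB : {multiplicative B -> G}) (iC : {multiplicative C -> G}) : Prop :=
  [/\ injective f, injective g & is_pushout f g iB iC].

Definition union_gens (B C G : groupType) (b c : nat)
    (gB : 'I_b -> B) (gC : 'I_c -> C) (iB : B -> G) (iC : C -> G)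
    (i : 'I_(b + c)) : G :=
  match split i with inl j => iB (gB j) | inr j => iC (gC j) end.

(* Main.v *)
Require Import Defs.
From HB Require Import structures.
From mathcomp Require Import all_boot.
From mathcomp Require Import boolp classical_sets cardinality.

Set Implicit Arguments.
Unset Strict Implicit.
Unset Printing Implicit Defensive.

(* Choose a product of elements of [M] in [B] and [C] that represents [x] in [M]
   and has as few factors as possible.  Two neighbours never lie in the same
   factor, and a factor in [A] could be merged with its neighbour, so the product
   is [d r1 ... rn] with [d] in [A], a reduced sequence [r], and all terms in [M].
   Given a word for [x], merging syllables yields [x = v s1 ... sm] with [v] in
   [A] and [s] reduced.  By the normal form theorem [x] is in [M] if and only if
   [m = n] and there are [e_0, ..., e_n = 1] in [A] with [m_0 e_0 = v] and
   [m_i e_i = e_(i-1) s_i] for some [m_i] in [M] in the factor of [s_i] ([m_0] in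
   [B]).  The set [S_i] of possible [e_i] is the intersection of [A] with the
   rational subset [M_X^-1 S_(i-1) s_i] of the factor [X] of [s_i], so an automaton
   for [S_i] can be computed from one for [S_(i-1)], provided that an automaton
   over the generators of [X] with values in [A] can be translated to the
   generators of [A].  This is done by conjugating each edge by words that lead
   from its endpoints to the final state.  It remains to test [1] in [S_n].

   The normal form theorem is derived from the universal property by letting [G]
   act on the set of normal forms [a t1 ... tn], where [t_i] runs through
   representatives of right cosets of [A].  Programs are obtained from closure
   properties of the class of computable functions between encoded types. *)

(** * Computable functions between encoded types *)

(** Instance resolution finds the encodings. They unfold to the encoders of the problem statements,
    so a program supplied by a decidability hypothesis is already a program for [computable]. *)
Class Enc (T : Type) := enc : T -> data.

Instance enc_data_inst : Enc data := id.
Instance enc_bool_inst : Enc bool := enc_bool.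
Instance enc_nat_inst : Enc nat := enc_nat.
Instance enc_unit_inst : Enc unit := fun _ => Leaf.
Instance enc_ord_inst (k : nat) : Enc 'I_k := fun i => enc_nat i.
Instance enc_prod_inst (X Y : Type) (eX : Enc X) (eY : Enc Y) : Enc (X * Y) :=
  enc_pair eX eY.
Instance enc_seq_inst (X : Type) (eX : Enc X) : Enc (seq X) := enc_seq eX.
Instance enc_sum_inst (X Y : Type) (eX : Enc X) (eY : Enc Y) : Enc (X + Y) :=
  fun u => match u with
           | inl x => Node Leaf (eX x)
           | inr y => Node (Node Leaf Leaf) (eY y)
           end.
Instance enc_fsa_inst (k : nat) : Enc (fsa k) := @enc_fsa k.

Definition computable {X Y : Type} `{Enc X, Enc Y} (f : X -> Y) : Prop :=
  exists p, forall x, exec p (enc x) (enc (f x)).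

(** * Composition, pairing and branching of programs *)

Fixpoint esub (e r : expr) : expr :=
  match e with
  | Var => r
  | ENil => ENil
  | ECons e1 e2 => ECons (esub e1 r) (esub e2 r)
  | EHd e1 => EHd (esub e1 r)
  | ETl e1 => ETl (esub e1 r)
  end.

Lemma eval_esub e r x : eval (esub e r) x = eval e (eval r x).
Proof. by elim: e => //= [e1 -> e2 ->|e1 ->|e1 ->]. Qed.

(** With a single variable, the left half of a pair serves as storage while [p] runs on the right
    half. *)
Fixpoint on_tl (p : prog) : prog :=
  match p with
  | Assign e => Assign (ECons (EHd Var) (esub e (ETl Var)))
  | Seq p q => Seq (on_tl p) (on_tl q)
  | While e p => While (esub e (ETl Var)) (on_tl p)
  end.

Lemma exec_on_tl p x y h : exec p x y -> exec (on_tl p) (Node h x) (Node h y).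
Proof.
elim=> {p x y} /=.
- move=> e x; have := exec_assign (ECons (EHd Var) (esub e (ETl Var))) (Node h x).
  by rewrite /= eval_esub.
- by move=> p q x y z _ IH1 _ IH2; apply: exec_seq IH1 IH2.
- by move=> e p x H; apply: exec_while_stop; rewrite eval_esub.
- move=> e p x y z H _ IH1 _ IH2.
  by apply: exec_while_step IH1 IH2; rewrite eval_esub.
Qed.

Lemma exec_eq_assign e x y : eval e x = y -> exec (Assign e) x y.
Proof. by move<-; apply: exec_assign. Qed.

Lemma comp_ext {X Y : Type} `{Enc X, Enc Y}
    (f g : X -> Y) : f =1 g -> computable f -> computable g.
Proof. by move=> fg [p Hp]; exists p => x; rewrite -fg. Qed.

Lemma comp_id {X : Type} `{Enc X} : computable (fun x : X => x).
Proof. by exists (Assign Var) => x; apply: exec_assign. Qed.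

Lemma comp_const {X Y : Type} `{Enc X, Enc Y}
    (y : Y) : computable (fun _ : X => y).
Proof.
have [e He] : exists e, forall x, eval e x = enc y.
  elim: (enc y) => [|d1 [e1 H1] d2 [e2 H2]]; first by exists ENil.
  by exists (ECons e1 e2) => x /=; rewrite H1 H2.
by exists (Assign e) => x; apply: exec_eq_assign.
Qed.

Lemma comp_comp {X Y Z : Type} `{Enc X, Enc Y, Enc Z}
    (g : Y -> Z) (f : X -> Y) :
  computable g -> computable f -> computable (fun x => g (f x)).
Proof.
by move=> [p Hp] [q Hq]; exists (Seq q p) => x; apply: exec_seq (Hq x) (Hp _).
Qed.

Lemma comp_pair {X Y Z : Type} `{Enc X, Enc Y, Enc Z}
    (f : X -> Y) (g : X -> Z) :
  computable f -> computable g -> computable (fun x => (f x, g x)).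
Proof.
move=> [p Hp] [q Hq].
pose sw := Assign (ECons (ETl Var) (EHd Var)).
(* The variable holds in turn [(x, x)], [(x, g x)], [(g x, x)], [(g x, f x)] and [(f x, g x)]. *)
exists (Seq (Assign (ECons Var Var)) (Seq (on_tl q) (Seq sw (Seq (on_tl p) sw))))
  => x.
apply: exec_seq (exec_assign _ _) _.
apply: exec_seq (exec_on_tl _ (Hq x)) _.
apply: exec_seq (exec_assign _ _) _.
apply: exec_seq (exec_on_tl _ (Hp x)) _.
exact: exec_assign.
Qed.

Lemma comp_fst {X Y Z : Type} `{Enc X, Enc Y, Enc Z}
    (f : X -> Y * Z) : computable f -> computable (fun x => (f x).1).
Proof.
move=> [p Hp]; exists (Seq p (Assign (EHd Var))) => x.
exact: exec_seq (Hp x) (exec_assign _ _).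
Qed.

Lemma comp_snd {X Y Z : Type} `{Enc X, Enc Y, Enc Z}
    (f : X -> Y * Z) : computable f -> computable (fun x => (f x).2).
Proof.
move=> [p Hp]; exists (Seq p (Assign (ETl Var))) => x.
exact: exec_seq (Hp x) (exec_assign _ _).
Qed.

Lemma comp_pair_data {X Y Z W : Type} `{Enc X, Enc Y, Enc Z, Enc W}
    (f : X -> Y) (g : X -> Z) (h : X -> W) :
  (forall x, enc (h x) = enc (f x, g x)) -> computable f -> computable g ->
  computable h.
Proof.
move=> hE cf cg; have [p Hp] := comp_pair cf cg; exists p => x.
by rewrite hE.
Qed.

(* The flags are needed because the two loops must run at most once, and the
   second one must not run after the first one. *)
Lemma comp_branch (X Y : Type) {eX : Enc X} {eY : Enc Y}
    (c : X -> data) (F : X -> Y) p1 p2 :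
  computable c ->
  (forall x, c x <> Leaf -> exec p1 (enc x) (enc (F x))) ->
  (forall x, c x = Leaf -> exec p2 (enc x) (enc (F x))) ->
  computable F.
Proof.
move=> cc H1 H2.
have [p Hp] := comp_pair (comp_pair cc (comp_const true)) comp_id.
pose clear := Assign (ECons (ECons ENil ENil) (ETl Var)).
pose once e p := While e (Seq (on_tl p) clear).
exists (Seq p (Seq (once (EHd (EHd Var)) p1)
         (Seq (once (ETl (EHd Var)) p2) (Assign (ETl Var))))) => x.
pose fin := Node (Node Leaf Leaf) (@enc Y eY (F x)).
have stop e q : eval e fin = Leaf -> exec (once e q) fin fin.
  exact: exec_while_stop.
have run e q h : eval e fin = Leaf -> eval e (Node h (enc x)) <> Leaf ->
    exec q (enc x) (enc (F x)) -> exec (once e q) (Node h (enc x)) fin.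
  move=> e0 e1 Hq; apply: exec_while_step e1 _ (exec_while_stop _ _) => //.
  exact: exec_seq (exec_on_tl _ Hq) (exec_assign _ _).
apply: exec_seq (Hp x) _; apply: (@exec_seq _ _ _ (if pselect (c x = Leaf) then
    enc (c x, true, x) else fin)).
  case: pselect => cx; first exact: exec_while_stop.
  exact: run (H1 _ cx).
apply: (@exec_seq _ _ _ fin); last exact: exec_assign.
case: pselect => cx; last exact: stop.
by apply: run (H2 _ cx).
Qed.

Lemma comp_if {X Y : Type} `{Enc X, Enc Y} (c : X -> bool) (f g : X -> Y) :
  computable c -> computable f -> computable g ->
  computable (fun x => if c x then f x else g x).
Proof.
move=> [pc Hc] [pf Hf] [pg Hg].
apply: (comp_branch (c := fun x => enc (c x)) (p1 := pf) (p2 := pg)).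
- by exists pc.
- by move=> x; case: (c x).
- by move=> x; case: (c x).
Qed.

Lemma comp_seq_case {X Y Z : Type} `{Enc X, Enc Y, Enc Z}
    (l : X -> seq Y) (f : X -> Z) (g : X -> Y -> seq Y -> Z) :
  computable l -> computable f ->
  computable (fun t : X * Y * seq Y => g t.1.1 t.1.2 t.2) ->
  computable (fun x => match l x with [::] => f x | y :: r => g x y r end).
Proof.
move=> cl [pf Hf] [pg Hg].
have [pl Hl] := cl.
have [p Hp] := comp_pair comp_id cl.
(* Since [y :: r] is encoded like [(y, r)], this regroups [(x, y :: r)] into [((x, y), r)]. *)
pose q := Assign (ECons (ECons (EHd Var) (EHd (ETl Var))) (ETl (ETl Var))).
apply: (comp_branch (c := fun x => enc (l x)) (p1 := Seq p (Seq q pg)) (p2 := pf)).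
- by exists pl.
- move=> x; have := Hp x; case: (l x) => // y r Hx _.
  apply: exec_seq Hx _.
  have /= Hq := Hg (x, y, r).
  by apply: exec_seq Hq; apply: exec_eq_assign.
- by move=> x; case: (l x).
Qed.

Lemma comp_sum_case {X Y Z W : Type} `{Enc X, Enc Y, Enc Z, Enc W}
    (u : X -> Y + W) (f : X -> Y -> Z) (g : X -> W -> Z) :
  computable u -> computable (fun t : X * Y => f t.1 t.2) ->
  computable (fun t : X * W => g t.1 t.2) ->
  computable (fun x => match u x with inl y => f x y | inr w => g x w end).
Proof.
move=> cu [pf Hf] [pg Hg].
have [pu Hu] := cu.
have [p Hp] := comp_pair comp_id cu.
pose q := Assign (ECons (EHd Var) (ETl (ETl Var))).
pose c x := if u x is inl _ then Leaf else Node Leaf Leaf.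
apply: (comp_branch (c := c) (p1 := Seq p (Seq q pg)) (p2 := Seq p (Seq q pf))).
- exists (Seq pu (Assign (EHd Var))) => x; apply: exec_seq (Hu x) _.
  by apply: exec_eq_assign; rewrite /c; case: (u x).
- move=> x; have := Hp x; rewrite /c; case: (u x) => // w Hx _.
  apply: exec_seq Hx _.
  by apply: exec_seq (Hg (x, w)); apply: exec_eq_assign.
- move=> x; have := Hp x; rewrite /c; case: (u x) => // y Hx _.
  apply: exec_seq Hx _.
  by apply: exec_seq (Hf (x, y)); apply: exec_eq_assign.
Qed.

Lemma comp_inl {X Y Z : Type} `{Enc X, Enc Y, Enc Z}
    (f : X -> Y) : computable f -> computable (fun x => inl (f x) : Y + Z).
Proof. by move=> cf; apply: (comp_pair_data _ (comp_const Leaf) cf). Qed.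

Lemma comp_inr {X Y Z : Type} `{Enc X, Enc Y, Enc Z}
    (f : X -> Z) : computable f -> computable (fun x => inr (f x) : Y + Z).
Proof. by move=> cf; apply: (comp_pair_data _ (comp_const (Node Leaf Leaf)) cf). Qed.

Lemma comp_cons {X Y : Type} `{Enc X, Enc Y} (f : X -> Y) (g : X -> seq Y) :
  computable f -> computable g -> computable (fun x => f x :: g x).
Proof. by move=> cf cg; apply: (comp_pair_data _ cf cg). Qed.

(** The number of rounds may depend on the input in any way, so unbounded search is included. *)
Lemma comp_while {X : Type} `{Enc X} (c : X -> bool) (h F : X -> X) :
  computable c -> computable h ->
  (forall x, exists n, [/\ forall i, i < n -> c (iter i h x),
                           ~~ c (iter n h x) & F x = iter n h x]) ->
  computable F.
Proof.
move=> cc [ph Hh] HF.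
have [p Hp] := comp_pair cc comp_id.
(* [While] tests only an expression, so the value of [c] is kept in front of the data and recomputed
   after each round. *)
pose w := While (EHd Var) (Seq (Assign (ETl Var)) (Seq ph p)).
exists (Seq p (Seq w (Assign (ETl Var)))) => x.
apply: exec_seq (Hp x) _.
have [n [Hi Hn ->]] := HF x.
apply: exec_seq; last exact: (exec_assign _ (enc (c (iter n h x), iter n h x))).
elim: n x Hi Hn {HF} => [|n IH] x Hi Hn.
  by apply: exec_while_stop => /=; move: Hn => /=; case: (c x).
apply: exec_while_step.
- by have /= := Hi 0 isT; case: (c x).
- apply: exec_seq (exec_assign _ _) _; apply: exec_seq (Hh x) (Hp _).
- rewrite iterSr; apply: IH; last by rewrite -iterSr.
  by move=> i ilt; rewrite -iterSr; apply: Hi.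
Qed.

Lemma comp_ap2 {X Y Z W : Type} `{Enc X, Enc Y, Enc Z, Enc W}
  (h : Y -> Z -> W) (f : X -> Y) (g : X -> Z) :
  computable (fun t : Y * Z => h t.1 t.2) -> computable f -> computable g ->
  computable (fun x => h (f x) (g x)).
Proof. by move=> ch cf cg; apply: (comp_comp ch (comp_pair cf cg)). Qed.

Lemma comp_ap3 {X Y Z W V : Type} `{Enc X, Enc Y, Enc Z, Enc W, Enc V}
    (h : Y -> Z -> W -> V)
  (f : X -> Y) (g : X -> Z) (k : X -> W) :
  computable (fun t : Y * Z * W => h t.1.1 t.1.2 t.2) -> computable f ->
  computable g -> computable k ->
  computable (fun x => h (f x) (g x) (k x)).
Proof.
move=> ch cf cg ck.
exact: (comp_comp ch (comp_pair (comp_pair cf cg) ck)).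
Qed.

(** A loop on triples of parameter, accumulator and remaining list. The later recursions on lists
    and numbers reduce to this one. *)
Lemma comp_foldl {X Y Z : Type} `{Enc X, Enc Y, Enc Z}
    (h : X -> Z -> Y -> Z) (i : X -> Z) (l : X -> seq Y) :
  computable (fun t : X * Z * Y => h t.1.1 t.1.2 t.2) -> computable i ->
  computable l ->
  computable (fun x => foldl (h x) (i x) (l x)).
Proof.
move=> ch ci cl.
pose F (t : X * Z * seq Y) := (t.1.1, foldl (h t.1.1) t.1.2 t.2, Nil Y).
have cF : computable F; last first.
  have := comp_comp cF (comp_pair (comp_pair comp_id ci) cl).
  by move/comp_fst/comp_snd.
pose c (t : X * Z * seq Y) := if t.2 is [::] then false else true.
pose k (t : X * Z * seq Y) :=
  if t.2 is y :: r then (t.1.1, h t.1.1 t.1.2 y, r) else t.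
apply: (comp_while (c := c) (h := k)).
- apply: (comp_seq_case (g := fun _ _ _ => true)); last exact: comp_const.
    exact/comp_snd/comp_id.
  exact: comp_const.
- apply: (comp_seq_case (g := fun t y r => (t.1.1, h t.1.1 t.1.2 y, r))).
  + exact/comp_snd/comp_id.
  + exact: comp_id.
  + have c1 : computable (fun t : X * Z * seq Y * Y * seq Y => t.1.1.1.1).
      exact/comp_fst/comp_fst/comp_fst/comp_fst/comp_id.
    have c2 : computable (fun t : X * Z * seq Y * Y * seq Y => t.1.1.1.2).
      exact/comp_snd/comp_fst/comp_fst/comp_fst/comp_id.
    have c3 : computable (fun t : X * Z * seq Y * Y * seq Y => t.1.2).
      exact/comp_snd/comp_fst/comp_id.
    apply: comp_pair; last exact/comp_snd/comp_id.
    apply: comp_pair => //.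
    exact: (comp_comp ch (comp_pair (comp_pair c1 c2) c3)).
- move=> [[x z] r]; exists (size r).
  elim: r z => [|y r IH] z //=.
  have [K1 K2 K3] := IH (h x z y).
  split.
  + by case=> // j; rewrite ltnS iterSr => /K1.
  + by rewrite -iterS iterSr.
  + by rewrite -iterS iterSr -[iter _ _ _]K3.
Qed.

(** Computability is proved by following the syntax of the function. The table of rules is extended
    below, once more closure properties are available. *)
Ltac comp_base :=
  match goal with
  | |- computable fst => exact: (comp_fst comp_id)
  | |- computable snd => exact: (comp_snd comp_id)
  | |- computable (fun x => x) => exact: comp_id
  | |- computable (fun _ => ?y) => exact: (comp_const y)
  | |- computable (fun x => (@?f x).1) => apply: (comp_fst (f := f))
  | |- computable (fun x => (@?f x).2) => apply: (comp_snd (f := f))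
  | |- computable (fun x => (@?f x, @?g x)) => apply: (comp_pair (f := f) (g := g))
  | |- computable (fun x => @?f x :: @?g x) => apply: (comp_cons (f := f) (g := g))
  | |- computable (fun x => inl (@?f x)) => apply: (comp_inl (f := f))
  | |- computable (fun x => inr (@?f x)) => apply: (comp_inr (f := f))
  | |- computable (fun x => if _ then _ else _) => apply: comp_if
  | |- computable (fun x => foldl (@?h x) (@?i x) (@?l x)) =>
      apply: (comp_foldl (h := h) (i := i) (l := l))
  end.

Ltac comp_step := cbv beta;
  first [comp_base | assumption
        | match goal with
          | H : computable ?h |- computable (fun x => ?h (@?f x)) =>
              apply: (comp_comp (f := f) H)
          | H : computable (fun t => ?h t.1 t.2)
            |- computable (fun x => ?h (@?f x) (@?g x)) =>
              apply: (comp_ap2 (f := f) (g := g) H)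
          end].
Ltac comp_tac := repeat comp_step.

(** * Booleans, lists and numbers *)

Lemma comp_andb {X : Type} `{Enc X} (f g : X -> bool) :
  computable f -> computable g -> computable (fun x => f x && g x).
Proof. by move=> cf cg; apply: comp_if => //; apply: comp_const. Qed.

Lemma comp_negb {X : Type} `{Enc X} (f : X -> bool) :
  computable f -> computable (fun x => ~~ f x).
Proof. by move=> cf; apply: comp_if => //; apply: comp_const. Qed.

Lemma comp_rev {X Y : Type} `{Enc X, Enc Y} (l : X -> seq Y) :
  computable l -> computable (fun x => rev (l x)).
Proof.
move=> cl.
apply: (comp_ext (f := fun x => foldl (fun r y => y :: r) [::] (l x))).
  by move=> x; rewrite /rev; elim: (l x) [::] => //= y s IH r; rewrite IH.
by apply: (comp_foldl (h := fun _ r y => y :: r)); comp_tac.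
Qed.

Lemma comp_foldr {X Y Z : Type} `{Enc X, Enc Y, Enc Z}
    (h : X -> Y -> Z -> Z) (i : X -> Z) (l : X -> seq Y) :
  computable (fun t : X * Y * Z => h t.1.1 t.1.2 t.2) -> computable i ->
  computable l ->
  computable (fun x => foldr (h x) (i x) (l x)).
Proof.
move=> ch ci cl.
apply: (comp_ext (f := fun x => foldl (fun z y => h x y z) (i x) (rev (l x)))).
  by move=> x; rewrite foldl_rev.
apply: (comp_foldl (h := fun x z y => h x y z)) => //; last exact: comp_rev.
by apply: (comp_ap3 ch); comp_tac.
Qed.

Lemma comp_map {X Y Z : Type} `{Enc X, Enc Y, Enc Z}
    (h : X -> Y -> Z) (l : X -> seq Y) :
  computable (fun t : X * Y => h t.1 t.2) -> computable l ->
  computable (fun x => map (h x) (l x)).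
Proof.
move=> ch cl.
apply: (comp_foldr (h := fun x y z => h x y :: z)) => //; last exact: comp_const.
by comp_tac.
Qed.

Lemma comp_filter {X Y : Type} `{Enc X, Enc Y}
    (h : X -> Y -> bool) (l : X -> seq Y) :
  computable (fun t : X * Y => h t.1 t.2) -> computable l ->
  computable (fun x => filter (h x) (l x)).
Proof.
move=> ch cl.
apply: (comp_foldr (h := fun x y z => if h x y then y :: z else z)) => //;
  last exact: comp_const.
by comp_tac.
Qed.

Lemma comp_has {X Y : Type} `{Enc X, Enc Y}
    (h : X -> Y -> bool) (l : X -> seq Y) :
  computable (fun t : X * Y => h t.1 t.2) -> computable l ->
  computable (fun x => has (h x) (l x)).
Proof.
move=> ch cl.
apply: (comp_foldr (h := fun x y z => if h x y then true else z)) => //;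
  last exact: comp_const.
by comp_tac.
Qed.

Lemma comp_cat {X Y : Type} `{Enc X, Enc Y} (f g : X -> seq Y) :
  computable f -> computable g -> computable (fun x => f x ++ g x).
Proof.
move=> cf cg; apply: (comp_ext (f := fun x => foldr cons (g x) (f x))).
  by move=> x; elim: (f x) => //= y s ->.
by apply: (comp_foldr (h := fun _ => cons)) => //; comp_tac.
Qed.

Lemma comp_flatten {X Y : Type} `{Enc X, Enc Y} (f : X -> seq (seq Y)) :
  computable f -> computable (fun x => flatten (f x)).
Proof.
move=> cf; apply: (comp_foldr (h := fun _ => cat)) => //; last exact: comp_const.
by apply: comp_cat; comp_tac.
Qed.

Lemma comp_head {X Y : Type} `{Enc X, Enc Y} (y : Y) (f : X -> seq Y) :
  computable f -> computable (fun x => head y (f x)).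
Proof.
move=> cf; apply: (comp_seq_case (g := fun _ y _ => y)) => //; comp_tac.
Qed.

Lemma comp_behead {X Y : Type} `{Enc X, Enc Y} (f : X -> seq Y) :
  computable f -> computable (fun x => behead (f x)).
Proof.
move=> cf; apply: (comp_seq_case (g := fun _ _ r => r)) => //; comp_tac.
Qed.

(** The unary numeral [n] and the list of [n] units have the same encoding, so the program for [f]
    serves unchanged, and arithmetic becomes list processing. *)
Lemma comp_nseq {X : Type} `{Enc X} (f : X -> nat) :
  computable f -> computable (fun x => nseq (f x) tt).
Proof.
move=> [p Hp]; exists p => x; have <- : enc (f x) = enc (nseq (f x) tt); last by [].
by elim: (f x) => //= n; rewrite /enc /= => ->.
Qed.

Lemma comp_size_unit {X : Type} `{Enc X} (f : X -> seq unit) :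
  computable f -> computable (fun x => size (f x)).
Proof.
move=> [p Hp]; exists p => x; have <- : enc (f x) = enc (size (f x)); last by [].
by elim: (f x) => //= u s; rewrite /enc /= => ->.
Qed.

Lemma comp_size {X Y : Type} `{Enc X, Enc Y} (f : X -> seq Y) :
  computable f -> computable (fun x => size (f x)).
Proof.
move=> cf; apply: (comp_ext (f := fun x => size (map (fun=> tt) (f x)))).
  by move=> x; rewrite size_map.
by apply: comp_size_unit; apply: (comp_map (h := fun _ _ => tt)); comp_tac.
Qed.

Lemma comp_iter {X Y : Type} `{Enc X, Enc Y}
    (n : X -> nat) (h : X -> Y -> Y) (i : X -> Y) :
  computable n -> computable (fun t : X * Y => h t.1 t.2) -> computable i ->
  computable (fun x => iter (n x) (h x) (i x)).
Proof.
move=> cn ch ci.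
apply: (comp_ext (f := fun x => foldr (fun _ y => h x y) (i x) (nseq (n x) tt))).
  by move=> x; elim: (n x) => //= m ->.
apply: (comp_foldr (h := fun x _ y => h x y)) => //; last exact: comp_nseq.
by apply: (comp_ap2 ch); comp_tac.
Qed.

Lemma comp_succn {X : Type} `{Enc X} (f : X -> nat) :
  computable f -> computable (fun x => (f x).+1).
Proof. by move=> cf; apply: (comp_pair_data _ (comp_const Leaf) cf). Qed.

Lemma comp_predn {X : Type} `{Enc X} (f : X -> nat) :
  computable f -> computable (fun x => (f x).-1).
Proof.
move=> cf; apply: (comp_ext (f := fun x => size (behead (nseq (f x) tt)))).
  by move=> x; rewrite size_behead size_nseq.
exact/comp_size_unit/comp_behead/comp_nseq.
Qed.

Lemma comp_addn {X : Type} `{Enc X} (f g : X -> nat) :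
  computable f -> computable g -> computable (fun x => f x + g x).
Proof.
move=> cf cg; apply: (comp_ext (f := fun x => iter (f x) S (g x))).
  by move=> x; elim: (f x) => //= n ->.
by apply: (comp_iter (h := fun _ => S)) => //; apply: comp_succn; comp_tac.
Qed.

Lemma comp_nilp {X Y : Type} `{Enc X, Enc Y} (f : X -> seq Y) :
  computable f -> computable (fun x => nilp (f x)).
Proof.
move=> cf; apply: (comp_ext (f := fun x => if f x is [::] then true else false)).
  by move=> x; case: (f x).
by apply: (comp_seq_case (g := fun _ _ _ => false)) => //; comp_tac.
Qed.

Lemma comp_eqn {X : Type} `{Enc X} (f g : X -> nat) :
  computable f -> computable g -> computable (fun x => f x == g x).
Proof.
have sub (h k : X -> nat) : computable h -> computable k ->
  computable (fun x => nilp (nseq (h x - k x) tt)).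
  move=> ch ck; apply/comp_nilp/comp_nseq.
  apply: (comp_ext (f := fun x => iter (k x) predn (h x))).
    by move=> x; elim: (k x) => /= [|n ->]; rewrite ?subn0 ?subnS.
  by apply: (comp_iter (h := fun _ => predn)) => //; apply: comp_predn; comp_tac.
move=> cf cg.
apply: (comp_ext (f := fun x => nilp (nseq (f x - g x) tt) && nilp (nseq (g x - f
  x) tt))).
  by move=> x; rewrite /nilp !size_nseq [RHS]eqn_leq /leq.
by apply: comp_andb; apply: sub.
Qed.

(** * Comparison with constants and finite tables *)

Lemma comp_enc {X Y : Type} `{Enc X, Enc Y} (f : X -> Y) :
  computable f -> computable (fun x => enc (f x)).
Proof. by move=> [p Hp]; exists p. Qed.

(** The program is built by induction on the constant [d], with one test per node. *)
Lemma comp_eq_data (d : data) : computable (fun x : data => `[< x = d >]).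
Proof.
have [pl Hl] : computable (fun x : data => if x is Node l _ then l else Leaf).
  by exists (Assign (EHd Var)) => x; apply: exec_eq_assign.
have [pr Hr] : computable (fun x : data => if x is Node _ r then r else Leaf).
  by exists (Assign (ETl Var)) => x; apply: exec_eq_assign.
have [pt Ht] := comp_const (X := data) true.
have [pf Hf] := comp_const (X := data) false.
elim: d => [|d1 IH1 d2 IH2].
  apply: (comp_branch (c := id) (p1 := pf) (p2 := pt)); first exact: comp_id.
    by move=> x x0; rewrite asboolF.
  by move=> x ->; rewrite asboolT.
have [p Hp] := comp_andb (comp_comp IH1 (ex_intro _ pl Hl))
                         (comp_comp IH2 (ex_intro _ pr Hr)).
apply: (comp_branch (c := id) (p1 := p) (p2 := pf)); first exact: comp_id.
  case=> // l r _; have := Hp (Node l r); congr exec; congr enc.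
  apply/idP/idP => [/andP[/asboolP-> /asboolP->]|/asboolP[-> ->]].
    exact/asboolP.
  by rewrite !asboolT.
by move=> x ->; rewrite asboolF.
Qed.

(** A lookup table: the finitely many values are built into the program, even if [F] was obtained by
    choice. For letters, this makes any selection of words for generators computable. *)
Lemma comp_fin (T : finType) (Y : Type) {eT : Enc T} {eY : Enc Y} (F : T -> Y) :
  injective (enc : T -> data) -> computable F.
Proof.
move=> einj.
have [/card0_eq T0|] := posnP #|T|.
  by exists (Assign Var) => x; move: (T0 x); rewrite inE.
case/card_gt0P=> t0 _.
have [G [cG GF]] :
    exists G : T -> Y, computable G /\ forall x, x \in enum T -> G x = F x;
  last by apply: comp_ext cG => x; apply: GF; rewrite mem_enum.
elim: (enum T) => [|t s [G [cG GF]]].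
  by exists (fun=> F t0); split=> //; apply: comp_const.
exists (fun x => if `[< enc x = enc t >] then F t else G x); split.
  apply: comp_if => //; last exact: comp_const.
  exact: (comp_comp (comp_eq_data _) (comp_enc comp_id)).
move=> x; rewrite inE; case: asboolP => [/einj->//|ne /orP[/eqP xt|/GF//]].
by rewrite xt in ne.
Qed.

Lemma enc_nat_inj : injective enc_nat.
Proof. by elim=> [|m IH] [|n] //= [/IH->]. Qed.

Lemma enc_letter_inj (k : nat) : injective (enc : 'I_k * bool -> data).
Proof.
move=> [i s] [j t] [/enc_nat_inj ij].
by rewrite (val_inj ij); case: s; case: t.
Qed.

Lemma comp_letter (k : nat) {Y : Type} `{Enc Y} {X : Type} `{Enc X}
  (F : letter k -> Y) (f : X -> letter k) : computable f ->
  computable (fun x => F (f x)).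
Proof. by apply: comp_comp; apply: (comp_fin F (@enc_letter_inj k)). Qed.

Ltac comp_base ::=
  match goal with
  | |- computable fst => exact: (comp_fst comp_id)
  | |- computable snd => exact: (comp_snd comp_id)
  | |- computable (fun x => x) => exact: comp_id
  | |- computable (fun _ => ?y) => exact: (comp_const y)
  | |- computable (fun x => (@?f x).1) => apply: (comp_fst (f := f))
  | |- computable (fun x => (@?f x).2) => apply: (comp_snd (f := f))
  | |- computable (fun x => (@?f x, @?g x)) => apply: (comp_pair (f := f) (g := g))
  | |- computable (fun x => @?f x :: @?g x) => apply: (comp_cons (f := f) (g := g))
  | |- computable (fun x => inl (@?f x)) => apply: (comp_inl (f := f))
  | |- computable (fun x => inr (@?f x)) => apply: (comp_inr (f := f))
  | |- computable (fun x => if _ then _ else _) => apply: comp_if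
  | |- computable (fun x => foldl (@?h x) (@?i x) (@?l x)) =>
      apply: (comp_foldl (h := h) (i := i) (l := l))
  | |- computable (fun x => foldr (@?h x) (@?i x) (@?l x)) =>
      apply: (comp_foldr (h := h) (i := i) (l := l))
  | |- computable (fun x => map (@?h x) (@?l x)) =>
    apply: (comp_map (h := h) (l := l))
  | |- computable (fun x => filter (@?h x) (@?l x)) =>
      apply: (comp_filter (h := h) (l := l))
  | |- computable (fun x => has (@?h x) (@?l x)) =>
    apply: (comp_has (h := h) (l := l))
  | |- computable (fun x => iter (@?n x) (@?h x) (@?i x)) =>
      apply: (comp_iter (n := n) (h := h) (i := i))
  | |- computable (fun x => @?f x ++ @?g x) => apply: (comp_cat (f := f) (g := g))
  | |- computable (fun x => flatten (@?f x)) => apply: (comp_flatten (f := f))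
  | |- computable (fun x => head ?y (@?f x)) => apply: (comp_head y (f := f))
  | |- computable (fun x => rev (@?f x)) => apply: (comp_rev (l := f))
  | |- computable (fun x => size (@?f x)) => apply: (comp_size (f := f))
  | |- computable (fun x => (@?f x).+1) => apply: (comp_succn (f := f))
  | |- computable (fun x => @?f x + @?g x) => apply: (comp_addn (f := f) (g := g))
  | |- computable (fun x => @?f x == @?g x) => apply: (comp_eqn (f := f) (g := g))
  | |- computable (fun x => ~~ @?f x) => apply: (comp_negb (f := f))
  | |- computable (fun x => @?f x && @?g x) => apply: (comp_andb (f := f) (g := g))
  end.

Local Open Scope classical_set_scope.

(** * Normal forms in an amalgamated free product *)

(** Permutations of an arbitrary type, the target group for the universal property. The inverse is
    stored; being unique, it does not affect equality. *)
Record bij (T : Type) := Bij {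
  bfun : T -> T;
  binv : T -> T;
  bfunK : cancel bfun binv;
  binvK : cancel binv bfun }.

Lemma bij_ext (T : Type) (u v : bij T) : bfun u =1 bfun v -> u = v.
Proof.
case: u v => [u u' uK u'K] [v v' vK v'K] /= /funext uv; subst v.
have u'v' : u' = v' by apply: funext => x; rewrite -{1}(v'K x) uK.
by subst v'; congr Bij; apply: Prop_irrelevance.
Qed.

HB.instance Definition _ (T : Type) := gen_eqMixin (bij T).
HB.instance Definition _ (T : Type) := gen_choiceMixin (bij T).

Section BijGroup.
Variable T : Type.

Definition bij_one : bij T := @Bij T id id (fun _ => erefl) (fun _ => erefl).
Definition bij_mul (u v : bij T) : bij T :=
  Bij (can_comp (bfunK u) (bfunK v)) (can_comp (binvK v) (binvK u)).
Definition bij_inv (u : bij T) : bij T := Bij (binvK u) (bfunK u).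

Lemma bij_mulA : associative bij_mul. Proof. by move=> u v w; apply: bij_ext. Qed.
Lemma bij_mul1 : left_id bij_one bij_mul. Proof. by move=> u; apply: bij_ext. Qed.
Lemma bij_mulr1 : right_id bij_one bij_mul. Proof. by move=> u; apply: bij_ext. Qed.
Lemma bij_mulV : left_inverse bij_one bij_inv bij_mul.
Proof. by move=> u; apply: bij_ext => x /=; rewrite bfunK. Qed.
Lemma bij_mulrV : right_inverse bij_one bij_inv bij_mul.
Proof. by move=> u; apply: bij_ext => x /=; rewrite binvK. Qed.

HB.instance Definition _ :=
  isGroup.Build (bij T) bij_mulA bij_mul1 bij_mulr1 bij_mulV bij_mulrV.

Lemma bfunM (u v : bij T) x : bfun (u * v)%g x = bfun u (bfun v x).
Proof. by []. Qed.

End BijGroup.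

Local Open Scope group_scope.

Lemma multf1 (K H : groupType) (f : {multiplicative K -> H}) : f 1 = 1.
Proof. by apply: (mulgI (f 1)); rewrite -gmulfM !mulg1. Qed.

Lemma multfV (K H : groupType) (f : {multiplicative K -> H}) : {morph f : x / x^-1}.
Proof. by move=> x; apply: (mulgI (f x)); rewrite -gmulfM !mulgV multf1. Qed.

(* Right cosets [A k] of [f A] in [K]: [k = f (cpart k) * crep k], where the
   representative of the trivial coset is [1]. *)
Section Cosets.
Variables (A K : groupType) (f : {multiplicative A -> K}).
Hypothesis finj : injective f.

Definition same_coset (k : K) : set K := [set h | exists x, h = f x * k].

Definition crep (k : K) : K := if `[< range f k >] then 1 else xget 1 (same_coset k).

Lemma crepP k : exists x, k == f x * crep k.
Proof.
rewrite /crep; case: asboolP => [[x _ <-]|_]; first by exists x; rewrite mulg1.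
have : same_coset k (xget 1 (same_coset k)).
  by apply: (xgetI 1 (x := k)); exists 1; rewrite multf1 mul1g.
by case=> x ->; exists x^-1; rewrite multfV mulKg.
Qed.

Definition cpart (k : K) : A := xchoose (crepP k).

Lemma cpart_crep k : f (cpart k) * crep k = k.
Proof. by have /eqP <- := xchooseP (crepP k). Qed.

Lemma rangeMl x k : range f (f x * k) <-> range f k.
Proof.
split=> [[y _ yE]|[y _ <-]]; last by exists (x * y); rewrite ?gmulfM.
by exists (x^-1 * y) => //; rewrite gmulfM multfV yE mulKg.
Qed.

(** The representative is chosen from the coset as a set, and [k] and [f x * k] have the same
    coset. *)
Lemma crepM x k : crep (f x * k) = crep k.
Proof.
rewrite /crep; have -> : `[< range f (f x * k) >] = `[< range f k >].
  exact/asbool_equiv_eq/rangeMl.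
case: asboolP => // _; congr (xget 1 _); apply/seteqP; split=> h [y ->].
  by exists (y * x); rewrite gmulfM mulgA.
by exists (y / x); rewrite gmulfM multfV mulgA mulgVK.
Qed.

Lemma cpartM x k : cpart (f x * k) = x * cpart k.
Proof.
apply: finj; apply: (mulIg (crep k)).
by rewrite gmulfM -mulgA cpart_crep -(crepM x) cpart_crep.
Qed.

Lemma crep_id k : crep (crep k) = crep k.
Proof. by rewrite -[in RHS](cpart_crep k) crepM. Qed.

Lemma crep1 k : range f k -> crep k = 1.
Proof. by move=> kA; rewrite /crep asboolT. Qed.

Lemma range_crep k : range f (crep k) <-> range f k.
Proof. by rewrite -[in X in _ <-> X](cpart_crep k); split=> /rangeMl. Qed.

Lemma cpart_crep1 k : cpart (crep k) = 1.
Proof.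
by apply: finj; apply: (mulIg (crep (crep k)));
  rewrite cpart_crep multf1 mul1g crep_id.
Qed.

Lemma cpart_range x : cpart (f x) = x.
Proof.
by apply: finj; rewrite -[RHS](cpart_crep (f x)) crep1 ?mulg1 //; exists x.
Qed.

End Cosets.

(* The action of one factor [K] on normal forms [(a, [:: t1; ...; tn])], which
   stand for [a t1 ... tn]; [L] is the type of syllables of both factors. *)
Section FactorAction.
Variables (A K : groupType) (f : {multiplicative A -> K}).
Hypothesis finj : injective f.
Variables (L : Type) (inj : K -> L) (prj : L -> option K).
Hypothesis injK : pcancel inj prj.
Hypothesis prjK : ocancel prj inj.
Variable valid : seq L -> Prop.

Definition starts (l : seq L) : bool := if l is y :: _ then prj y : bool else false.

Hypothesis valid_cons : forall t l, valid (inj t :: l) <->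
  [/\ crep f t = t, ~ range f t, ~~ starts l & valid l].

(** A normal form as an element of [K] followed by a rest that does not start in [K]. Since
    [nf_join] is the inverse, [nf_act] is left multiplication carried over along a bijection, hence
    an action. *)
Definition nf_split (x : A * seq L) : K * seq L :=
  if x.2 is y :: l then
    if prj y is Some t then (f x.1 * t, l) else (f x.1, x.2)
  else (f x.1, x.2).

Definition nf_join (u : K * seq L) : A * seq L :=
  (cpart f u.1, if `[< range f u.1 >] then u.2 else inj (crep f u.1) :: u.2).

Definition nf_act (k : K) (x : A * seq L) : A * seq L :=
  nf_join (k * (nf_split x).1, (nf_split x).2).

Lemma nf_join_split x : valid x.2 -> nf_join (nf_split x) = x.
Proof.
case: x => a [|y l] /=; rewrite /nf_split /nf_join /=.
  by move=> _; rewrite asboolT ?cpart_range //; exists a.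
have := prjK y; case: (prj y) => /= [t <-|_ _] /=.
  case/valid_cons=> tr tA _ _; rewrite asboolF; last by move/rangeMl.
  by rewrite cpartM // crepM tr -tr cpart_crep1 // mulg1.
by rewrite asboolT ?cpart_range //; exists a.
Qed.

Lemma nf_split_join u : ~~ starts u.2 -> nf_split (nf_join u) = u.
Proof.
case: u => k l /=; rewrite /nf_split /nf_join /=; case: asboolP => kA.
  rewrite -[in f _](mulg1 (cpart f k)).
  have fk : f (cpart f k) = k by rewrite -[RHS](cpart_crep f k) crep1 // mulg1.
  by rewrite mulg1; case: l => [|y l] /=; rewrite ?fk //; case: (prj y).
by rewrite injK cpart_crep.
Qed.

Lemma nf_split_valid x : valid x.2 ->
  ~~ starts (nf_split x).2 /\ valid (nf_split x).2.
Proof.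
case: x => a [|y l] //= vl; rewrite /nf_split /=.
have := prjK y; case E: (prj y) => [t|] /= yE; last by rewrite E.
by move: vl; rewrite -yE => /valid_cons[].
Qed.

Lemma nf_join_valid u : ~~ starts u.2 -> valid u.2 -> valid (nf_join u).2.
Proof.
case: u => k l /= sl vl; case: asboolP => // kA.
by apply/valid_cons; split; rewrite ?crep_id // => /range_crep.
Qed.

Lemma nf_act_valid k x : valid x.2 -> valid (nf_act k x).2.
Proof. by case/nf_split_valid=> ? ?; apply: nf_join_valid. Qed.

Lemma nf_actM k h x : valid x.2 -> nf_act (k * h) x = nf_act k (nf_act h x).
Proof.
by case/nf_split_valid=> sx vx; rewrite /nf_act nf_split_join //= mulgA.
Qed.

Lemma nf_act1 x : valid x.2 -> nf_act 1 x = x.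
Proof. by move=> vx; rewrite /nf_act mul1g -surjective_pairing nf_join_split. Qed.

Lemma nf_actA a x : valid x.2 -> nf_act (f a) x = (a * x.1, x.2).
Proof.
move=> vx; rewrite -[in RHS](nf_join_split vx) /nf_act /nf_join /=.
rewrite cpartM // crepM; congr (_, _).
by rewrite (asbool_equiv_eq (rangeMl f a (nf_split x).1)).
Qed.

Definition nf_type := {x : A * seq L | valid x.2}.

Lemma nf_type_inj (x y : nf_type) : sval x = sval y -> x = y.
Proof. by case: x y => x vx [y vy] /= xy; apply: eq_exist. Qed.

Definition nf_fun k (x : nf_type) : nf_type :=
  exist _ (nf_act k (sval x)) (nf_act_valid k (proj2_sig x)).

Lemma nf_fun_inv k h : h * k = 1 -> cancel (nf_fun k) (nf_fun h).
Proof.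
by move=> hk x; apply: nf_type_inj => /=; rewrite -nf_actM ?hk ?nf_act1 //;
  exact: (proj2_sig x).
Qed.

Definition nf_bij k : bij nf_type :=
  Bij (nf_fun_inv (mulVg k)) (nf_fun_inv (mulgV k)).

Lemma nf_bijM : {morph nf_bij : k h / k * h}.
Proof.
move=> k h; apply: bij_ext => x; rewrite bfunM; apply: nf_type_inj.
exact: nf_actM (proj2_sig x).
Qed.

Lemma nf_morph : exists phi : {multiplicative K -> bij nf_type},
  forall k x, sval (bfun (phi k) x) = nf_act k (sval x).
Proof.
pose m := isMultiplicative.Build _ _ nf_bij nf_bijM.
pose phi : {multiplicative K -> bij nf_type} := HB.pack nf_bij m.
by exists phi.
Qed.

(** The action is free, which makes the map from the factor to the amalgam injective. *)
Lemma nf_act_inj x k h : valid x.2 -> nf_act k x = nf_act h x -> k = h.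
Proof.
case/nf_split_valid=> sx vx /(congr1 nf_split).
by rewrite !nf_split_join //= => -[] /mulIg.
Qed.

Lemma nf_act_new k a l : ~~ starts l -> ~ range f k ->
  nf_act k (a, l) = (cpart f (k * f a), inj (crep f (k * f a)) :: l).
Proof.
move=> sl kA; rewrite /nf_act.
have -> : nf_split (a, l) = (f a, l).
  by rewrite /nf_split; move: sl; case: l => //= y l; case: (prj y).
rewrite /nf_join /= asboolF // => -[x _ xE].
by apply: kA; exists (x / a) => //; rewrite gmulfM multfV xE mulgK.
Qed.

End FactorAction.

Opaque nf_act.

(** In the application [u], [v], [p], [q] come from [A] and [c] is a common coset representative of
    [k * u] and [h * v]; the conclusion is one link of [interp]. *)
Lemma coset_ratio (K : groupType) (k h u v p q c : K) :
  p * c = k * u -> q * c = h * v -> q / p * k = h * (v / u).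
Proof.
move=> Ep Eq; rewrite (canRL (mulgK v) (esym Eq)) mulgA mulgVK.
by rewrite (canRL (mulgK u) (esym Ep)) !mulgA mulgVK.
Qed.

(** * The action of the amalgam and the normal form theorem *)

Section Amalgam.
Variables (A B C G : groupType).
Variables (f : {multiplicative A -> B}) (g : {multiplicative A -> C}).
Variables (iB : {multiplicative B -> G}) (iC : {multiplicative C -> G}).
Hypothesis hG : is_amalgam f g iB iC.

Definition getl (y : B + C) : option B := if y is inl t then Some t else None.
Definition getr (y : B + C) : option C := if y is inr t then Some t else None.

Fixpoint nf_valid (l : seq (B + C)) : Prop :=
  match l with
  | [::] => True
  | inl t :: l' => [/\ crep f t = t, ~ range f t, ~~ starts getl l' & nf_valid l']
  | inr t :: l' => [/\ crep g t = t, ~ range g t, ~~ starts getr l' & nf_valid l']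
  end.

Fixpoint reduced (s : seq (B + C)) : Prop :=
  match s with
  | [::] => True
  | inl k :: s' => [/\ ~ range f k, ~~ starts getl s' & reduced s']
  | inr k :: s' => [/\ ~ range g k, ~~ starts getr s' & reduced s']
  end.

Definition syl_val (y : B + C) : G :=
  match y with inl k => iB k | inr k => iC k end.
Definition spell (s : seq (B + C)) : G := foldr (fun y x => syl_val y * x) 1 s.

(* [interp d s r]: the equation [d s1 ... sn = r1 ... rm] holds because [n = m] and
   elements [d = d_1, ..., d_(n+1) = 1] of [A] satisfy [d_i s_i = r_i d_(i+1)]. *)
Inductive interp : A -> seq (B + C) -> seq (B + C) -> Prop :=
  | interp_nil : interp 1 [::] [::]
  | interp_l d d' k h s r : f d * k = h * f d' -> interp d' s r ->
      interp d (inl k :: s) (inl h :: r)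
  | interp_r d d' k h s r : g d * k = h * g d' -> interp d' s r ->
      interp d (inr k :: s) (inr h :: r).

Let finj : injective f. Proof. by case: hG. Qed.
Let ginj : injective g. Proof. by case: hG. Qed.
Let getlK : ocancel getl inl. Proof. by case. Qed.
Let getrK : ocancel getr inr. Proof. by case. Qed.

Let validl t l : nf_valid (inl t :: l) <->
  [/\ crep f t = t, ~ range f t, ~~ starts getl l & nf_valid l].
Proof. by []. Qed.
Let validr t l : nf_valid (inr t :: l) <->
  [/\ crep g t = t, ~ range g t, ~~ starts getr l & nf_valid l].
Proof. by []. Qed.

Let nf := nf_type A nf_valid.
Local Notation actB := (@nf_act A B f (B + C) inl getl).
Local Notation actC := (@nf_act A C g (B + C) inr getr).

(** Through either factor [A] acts by multiplying the leading part of a normal form, so the two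
    actions agree on [A] and the universal property joins them. *)
Lemma amalgam_action : exists theta : {multiplicative G -> bij nf},
  (forall k x, sval (bfun (theta (iB k)) x) = actB k (sval x)) /\
  (forall k x, sval (bfun (theta (iC k)) x) = actC k (sval x)).
Proof.
have [phi phiE] : exists phi : {multiplicative B -> bij nf},
    forall k x, sval (bfun (phi k) x) = actB k (sval x).
  exact: (nf_morph finj (fun=> erefl) getlK validl).
have [psi psiE] : exists psi : {multiplicative C -> bij nf},
    forall k x, sval (bfun (psi k) x) = actC k (sval x).
  exact: (nf_morph ginj (fun=> erefl) getrK validr).
have [_ _ [_ /(_ _ phi psi)[]]] := hG.
  move=> a; apply: bij_ext => x; apply: nf_type_inj; rewrite phiE psiE.
  by rewrite (nf_actA finj getlK validl) ?(nf_actA ginj getrK validr) //;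
    exact: (proj2_sig x).
move=> theta [tB tC _]; exists theta; split=> k x; first by rewrite tB phiE.
by rewrite tC psiE.
Qed.

Lemma amalgam_inj_l : injective iB.
Proof.
move=> k h kh; have [theta [tB _]] := amalgam_action.
pose x0 : nf := exist _ (1, [::]) I.
apply: (nf_act_inj (fun=> erefl) getlK validl (proj2_sig x0)).
by rewrite -!tB kh.
Qed.

Lemma amalgam_inj_r : injective iC.
Proof.
move=> k h kh; have [theta [_ tC]] := amalgam_action.
pose x0 : nf := exist _ (1, [::]) I.
apply: (nf_act_inj (fun=> erefl) getrK validr (proj2_sig x0)).
by rewrite -!tC kh.
Qed.

Fixpoint nf_of (s : seq (B + C)) : A * seq (B + C) :=
  match s with
  | [::] => (1, [::])
  | inl k :: s' => actB k (nf_of s')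
  | inr k :: s' => actC k (nf_of s')
  end.

(** Along a reduced sequence each syllable creates a new one in its own factor; this provides the
    hypothesis of [nf_act_new] for the next syllable. *)
Lemma nf_of_starts s : reduced s ->
  (starts getl (nf_of s).2 = starts getl s) *
  (starts getr (nf_of s).2 = starts getr s).
Proof.
elim: s => //= -[] k s IH [kA ss /IH[IHl IHr]].
  by move: IHl; case: (nf_of s) => a l /= IHl; rewrite nf_act_new ?IHl.
by move: IHr; case: (nf_of s) => a l /= IHr; rewrite nf_act_new ?IHr.
Qed.

(** The sequences are compared syllable by syllable: equal representatives give a link by
    [coset_ratio], while different lengths or factors would make the normal forms start
    differently. *)
Lemma interp_nf_of s r a1 a2 l : reduced s -> reduced r ->
  nf_of s = (a1, l) -> nf_of r = (a2, l) -> interp (a2 / a1) s r.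
Proof.
elim: s r a1 a2 l => [|x s IH] r a1 a2 l rs rr Es Er.
  case: r rr Er => [_ [<- _]|y r rr Er].
    by case: Es => <- _; rewrite mulgV; constructor.
  by have := nf_of_starts rr; rewrite Er -[l]/((a1, l).2) -Es /=;
    case: y {rr Er} => k [].
case: r rr Er => [|y r] rr Er.
  by have := nf_of_starts rs; rewrite Es -[l]/((a2, l).2) -Er /=;
    case: x {rs Es} => k [].
case: x rs Es => k rs Es; case: y rr Er => h rr Er.
- move: rs rr => /= [kA ss rs] [hA sr rr]; move: Es Er => /=.
  case Es: (nf_of s) => [b1 l1]; case Er: (nf_of r) => [b2 l2].
  have [Hs _] := nf_of_starts rs; have [Hr _] := nf_of_starts rr.
  rewrite Es /= in Hs; rewrite Er /= in Hr.
  rewrite !nf_act_new ?Hs ?Hr // => -[<- <-] [<- hk ll].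
  subst l2; apply: interp_l (IH _ _ _ _ rs rr Es Er).
  rewrite !gmulfM !multfV.
  apply: coset_ratio (cpart_crep f _) _.
  by rewrite -hk cpart_crep.
- have [El _] := nf_of_starts rs; have [Er' _] := nf_of_starts rr.
  by move: El Er'; rewrite Es Er /= => ->.
- have [El _] := nf_of_starts rs; have [Er' _] := nf_of_starts rr.
  by move: El Er'; rewrite Es Er /= => ->.
- move: rs rr => /= [kA ss rs] [hA sr rr]; move: Es Er => /=.
  case Es: (nf_of s) => [b1 l1]; case Er: (nf_of r) => [b2 l2].
  have [_ Hs] := nf_of_starts rs; have [_ Hr] := nf_of_starts rr.
  rewrite Es /= in Hs; rewrite Er /= in Hr.
  rewrite !nf_act_new ?Hs ?Hr // => -[<- <-] [<- hk ll].
  subst l2; apply: interp_r (IH _ _ _ _ rs rr Es Er).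
  rewrite !gmulfM !multfV.
  apply: coset_ratio (cpart_crep g _) _.
  by rewrite -hk cpart_crep.
Qed.

(** The normal form theorem: both sides are applied to the trivial normal form, which [spell t]
    sends to [nf_of t]. *)
Lemma amalgam_interp a b s r : reduced s -> reduced r ->
  iB (f a) * spell s = iB (f b) * spell r -> interp (b^-1 * a) s r.
Proof.
move=> rs rr E; have [theta [tB tC]] := amalgam_action.
pose x0 : nf := exist _ (1, [::]) I.
have spellE t : sval (bfun (theta (spell t)) x0) = nf_of t.
  elim: t => [|[k|k] t IH] /=; first by rewrite multf1.
    by rewrite gmulfM bfunM tB IH.
  by rewrite gmulfM bfunM tC IH.
have spellAE c t : sval (bfun (theta (iB (f c) * spell t)) x0)
    = (c * (nf_of t).1, (nf_of t).2).
  rewrite gmulfM bfunM tB spellE (nf_actA finj getlK validl) //.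
  by have := proj2_sig (bfun (theta (spell t)) x0); rewrite spellE.
have := spellAE a s; rewrite E spellAE => -[Ea El].
case Es: (nf_of s) Ea El => [a1 l]; case Er: (nf_of r) => [a2 l'] /= Ea El; subst l'.
have -> : b^-1 * a = a2 / a1 by apply: (mulgI b); rewrite mulVKg mulgA Ea mulgK.
exact: interp_nf_of Er.
Qed.

End Amalgam.

(** * Automata with words as labels *)

Section Words.
Variables (K : groupType) (k : nat) (g : 'I_k -> K).

Lemma word_val_nil : word_val g [::] = 1.
Proof. exact: big_nil. Qed.

Lemma word_val_cons l w : word_val g (l :: w) = letter_val g l * word_val g w.
Proof. exact: big_cons. Qed.

Lemma word_val_cat v w : word_val g (v ++ w) = word_val g v * word_val g w.
Proof. exact: big_cat. Qed.

Lemma word_val1 l : word_val g [:: l] = letter_val g l.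
Proof. by rewrite word_val_cons word_val_nil mulg1. Qed.

Definition word_inv (w : word k) : word k := rev [seq (l.1, ~~ l.2) | l <- w].

Lemma word_val_inv w : word_val g (word_inv w) = (word_val g w)^-1.
Proof.
elim: w => [|[i s] w IH]; first by rewrite /word_inv /= word_val_nil invg1.
rewrite /word_inv /= rev_cons -cats1 word_val_cat IH word_val1 word_val_cons invgM.
by congr (_ * _); rewrite /letter_val /=; case: s; rewrite ?invgK.
Qed.

End Words.

(* Labelled edges; [reach val E r p x] says that some path of [E] from [p] to
   [r] has value [x]. *)
Section Reach.
Variables (L : eqType) (K : groupType) (val : L -> K).
Implicit Type E : seq (nat * L * nat).

Inductive reach E (r : nat) : nat -> K -> Prop :=
  | reach_refl : reach E r r 1
  | reach_step p w q x : (p, w, q) \in E -> reach E r q x -> reach E r p (val w * x).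

Lemma reach_trans E p q r x y : reach E q p x -> reach E r q y -> reach E r p (x * y).
Proof.
elim=> [|{}p w s {}x ps _ IH] Hy; first by rewrite mul1g.
by rewrite -mulgA; apply: reach_step ps (IH Hy).
Qed.

Lemma reach_edge E p w q : (p, w, q) \in E -> reach E q p (val w).
Proof. by move=> pq; rewrite -[val w]mulg1;
  apply: reach_step pq (reach_refl _ _). Qed.

Lemma reach_sub E E' r p x : {subset E <= E'} -> reach E r p x -> reach E' r p x.
Proof.
move=> EE; elim=> [|{}p w q {}x pq _ IH]; first exact: reach_refl.
exact: reach_step (EE _ pq) IH.
Qed.

Lemma reach_mem E E' r p x : E =i E' -> reach E r p x <-> reach E' r p x.
Proof. by move=> EE; split; apply: reach_sub => e; rewrite EE. Qed.

End Reach.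

Lemma reach_sim (L L' : eqType) (K : groupType)
    (val : L -> K) (val' : L' -> K) E E' r p x :
  (forall p w q, (p, w, q) \in E -> reach val' E' q p (val w)) ->
  reach val E r p x -> reach val' E' r p x.
Proof.
move=> EE; elim=> [|{}p w q {}x pq _ IH]; first exact: reach_refl.
exact: reach_trans (EE _ _ _ pq) IH.
Qed.

Lemma fsa_setE (K : groupType) (k : nat) (g : 'I_k -> K) (F : fsa k) x :
  fsa_set g F x <-> exists p q, [/\ p \in fsa_init F, q \in fsa_final F
    & reach (letter_val g) (fsa_trans F) q p x].
Proof.
split.
  case=> w [p [q [ip qf pw]]] <-; exists p, q; split=> //.
  elim: w p pw {ip} => [|l w IH] p /=.
    by move->; rewrite word_val_nil; apply: reach_refl.
  by case=> r pr /IH; rewrite word_val_cons; apply: reach_step.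
case=> p [q [ip qf pq]].
suff [w pw <-] : exists2 w, fsa_path F p w q & word_val g w = x.
  by exists w => //; exists p, q.
elim: pq {ip} => [|{}p l r {}x pr _ [w rw <-]].
  by exists [::]; rewrite ?word_val_nil.
by exists (l :: w); rewrite ?word_val_cons //; exists r.
Qed.

(* The automaton with these edges, initial state [0] and final state [1]. *)
Definition edges (k : nat) : Type := seq (nat * word k * nat).

(** States move up by two to make room for a single initial state [0] and a single final state [1],
    attached by edges with empty label. *)
Definition of_fsa (k : nat) (F : fsa k) : edges k :=
  [seq (0, [::], p.+2) | p <- fsa_init F] ++
  [seq (e.1.1.+2, [:: e.1.2], e.2.+2) | e <- fsa_trans F] ++
  [seq (p.+2, [::], 1%N) | p <- fsa_final F].

Lemma of_fsaP (K : groupType) (k : nat) (g : 'I_k -> K) (F : fsa k) x :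
  reach (word_val g) (of_fsa F) 1%N 0 x <-> fsa_set g F x.
Proof.
split=> [H|/fsa_setE[p [q [ip qf pq]]]].
  (* The values of paths from [s] to [1], described in terms of the original automaton. *)
  pose P s x := match s with
    | 0 => fsa_set g F x
    | 1 => x = 1
    | p.+2 => exists2 q, q \in fsa_final F & reach (letter_val g) (fsa_trans F) q p x
    end.
  rewrite -[fsa_set g F x]/(P 0 x); elim: H => // {}x0 w q {}x.
  rewrite !mem_cat => /or3P[] /mapP[y yF [-> -> ->]] _ /=.
  - case=> r rf yr; rewrite word_val_nil mul1g; apply/fsa_setE.
    by exists y, r.
  - case=> r rf yr; exists r => //; rewrite word_val1.
    by apply: reach_step yr; case: y yF => [[? ?] ?].
  - move=> ->; exists y => //; rewrite word_val_nil mulg1; exact: reach_refl.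
rewrite -[x]mul1g -[x]mulg1 -{1}(word_val_nil g).
apply: (@reach_step _ _ _ _ _ _ _ p.+2).
  by rewrite mem_cat map_f.
apply: (@reach_trans _ _ _ _ _ q.+2).
  elim: pq {ip} => [|{}p l r {}x pr _ IH]; first exact: reach_refl.
  rewrite -word_val1; apply: reach_step IH.
  by rewrite !mem_cat (map_f (fun e => (e.1.1.+2, [:: e.1.2], e.2.+2)) pr) orbT.
rewrite -(word_val_nil g); apply: reach_edge.
by rewrite !mem_cat (map_f (fun p => (p.+2, [::], 1%N)) qf) !orbT.
Qed.

(** * Subdividing edges until every label is a letter *)

Section Subdivide.
Variables (K : groupType) (k : nat) (g : 'I_k -> K).
Implicit Types (E R : edges k) (w v : word k).

Local Notation wreach := (reach (word_val g)).

Definition bounded E n := all (fun e => (e.1.1 < n) && (e.2 < n)) E.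

Lemma boundedP E n p w q : bounded E n -> (p, w, q) \in E -> p < n /\ q < n.
Proof. by move=> /allP bE /bE /= /andP. Qed.

Lemma bounded_leq E m n : m <= n -> bounded E m -> bounded E n.
Proof.
move=> mn; apply: sub_all => e /andP[h1 h2].
by rewrite !(leq_trans _ mn).
Qed.

Lemma bounded_cat E E' n : bounded (E ++ E') n = bounded E n && bounded E' n.
Proof. exact: all_cat. Qed.

(** By boundedness no other edge touches the new state [n], so a path that enters it by [u] must
    leave it by [v]. *)
Lemma reach_split R p u v q n r s x : bounded R n -> p < n -> q < n -> r < n ->
  s < n ->
  wreach ((p, u ++ v, q) :: R) r s x <->
  wreach ((p, u, n) :: (n, v, q) :: R) r s x.
Proof.
move=> bR pn qn rn sn; split.
  apply: reach_sim => p' w q'; rewrite inE => /orP[/eqP[-> -> ->]|p'q'].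
    rewrite word_val_cat; apply: (@reach_trans _ _ _ _ _ n).
      by apply: reach_edge; rewrite mem_head.
    by apply: reach_edge; rewrite inE mem_head orbT.
  by apply: reach_edge; rewrite !inE p'q' !orbT.
pose E : edges k := (p, u ++ v, q) :: R; rewrite -/E.
have ltF m : m < n -> m <> n by move=> mn mE; rewrite mE ltnn in mn.
(* The induction must also cover paths that start at [n]: they correspond to paths from [q] once [v]
   is cancelled. *)
move=> H; suff [] : (s <> n -> wreach E r s x) /\
    (s = n -> wreach E r q ((word_val g v)^-1 * x)) by move=> + _; apply; apply: ltF.
elim: H {sn} => [|{}s w s' {}x].
  by split; [move=> _; apply: reach_refl|move/(ltF _ rn)].
rewrite !inE => /or3P[/eqP[-> -> ->] _ [_ /(_ erefl) IH]
  |/eqP[-> -> ->] _ [IH _]|ss' _ [IH _]].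
- split; last by move/(ltF _ pn).
  move=> _; have := reach_step (mem_head _ _ : (p, u ++ v, q) \in E) IH.
  by rewrite word_val_cat -mulgA mulVKg.
- by split=> // _; rewrite mulKg; apply: IH; apply: ltF.
- have [sn s'n] := boundedP bR ss'.
  split; last by move/(ltF _ sn).
  by move=> _; apply: reach_step (IH (ltF _ s'n)); rewrite inE ss' orbT.
Qed.

(* [chain q n v = (t, m, T)]: reading [v] from the new state [t] leads to [q],
   through the states [n, ..., m - 1]. *)
Definition chain (q n : nat) (v : word k) :
    nat * nat * seq (nat * letter k * nat) :=
  foldr (fun l c => (c.1.2, c.1.2.+1, (c.1.2, l, c.1.1) :: c.2)) (q, n, [::]) v.

Definition as_words (T : seq (nat * letter k * nat)) : edges k :=
  [seq (e.1.1, [:: e.1.2], e.2) | e <- T].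

Lemma reach_as_words T r p x :
  wreach (as_words T) r p x <-> reach (letter_val g) T r p x.
Proof.
split; apply: reach_sim => p' w q'.
  case/mapP=> [[[p0 l] q0] pq [-> -> ->]]; rewrite word_val1.
  exact: reach_edge pq.
move=> pq; rewrite -word_val1; apply: reach_edge.
by apply/mapP; exists (p', w, q').
Qed.

(** Induction on [v] with a general prefix [u]: the induction hypothesis detaches all but the first
    letter of [v], and [reach_split] detaches that one. *)
Lemma chainP q n v (c := chain q n v) : q < n ->
  [/\ n <= c.1.2, c.1.1 < c.1.2, bounded (as_words c.2) c.1.2
    & forall R p u r s x, bounded R n -> p < n -> r < n -> s < n ->
      wreach ((p, u ++ v, q) :: R) r s x <->
      wreach ((p, u, c.1.1) :: as_words c.2 ++ R) r s x].
Proof.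
move=> qn; rewrite {}/c; elim: v => [|l v [nm tm bc IH]] /=.
  by split=> // R p u r s x; rewrite cats0.
move: nm tm bc IH; case: (chain q n v) => [[t m] T] /= nm tm bc IH.
split=> //; first exact: leqW.
  by rewrite ltnSn leqW //=; apply: bounded_leq bc.
move=> R p u r s x bR pn rn sn.
have le j : j < n -> j < m by move/leq_trans; apply.
rewrite -cat_rcons -cats1 IH //; apply: reach_split => //; try exact: le.
by rewrite bounded_cat bc (bounded_leq nm).
Qed.

End Subdivide.

(** Each label [w] is replaced by [l0 l0^-1 w], of equal value: the edge keeps [l0] and the rest
    goes into a chain. Thus empty labels need no separate treatment. *)
Definition to_fsa_edges (k : nat) (N : nat) (l0 : letter k) (E : edges k) :
    nat * seq (nat * letter k * nat) :=
  foldr (fun e d =>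
      let c := chain e.2 d.1 ((l0.1, ~~ l0.2) :: e.1.2) in
      (c.1.2, (e.1.1, l0, c.1.1) :: c.2 ++ d.2))
    (N, [::]) E.

Lemma to_fsa_edges_cons (k : nat) N (l0 : letter k) p w q (E : edges k) :
  to_fsa_edges N l0 ((p, w, q) :: E) =
  let d := to_fsa_edges N l0 E in
  let c := chain q d.1 ((l0.1, ~~ l0.2) :: w) in
  (c.1.2, (p, l0, c.1.1) :: c.2 ++ d.2).
Proof. by []. Qed.

Lemma to_fsa_edgesP (K : groupType) (k : nat) (g : 'I_k -> K) N l0 (E : edges k)
    (d := to_fsa_edges N l0 E) : bounded E N ->
  [/\ N <= d.1, bounded (as_words d.2) d.1
    & forall R r s x, bounded R N -> r < N -> s < N ->
      reach (word_val g) (E ++ R) r s x <->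
      reach (word_val g) (as_words d.2 ++ R) r s x].
Proof.
rewrite {}/d; elim: E => [|[[p w] q] E IH]; first by [].
have -> : bounded ((p, w, q) :: E) N = [&& p < N, q < N & bounded E N].
  by rewrite /bounded /= andbA.
case/and3P=> pN qN /IH; rewrite to_fsa_edges_cons {IH}.
move: (to_fsa_edges N l0 E) => [n T] [Nn bT IH]; rewrite /= in Nn bT IH.
set v := (l0.1, ~~ l0.2) :: w; cbv zeta; rewrite ![(n, T).1]/= ![(n, T).2]/=.
have [] := @chainP K k g q n v; first exact: leq_trans Nn.
case: (chain q n v) => [[t m] T'] /= nm tm bT' HT'.
have bTm := bounded_leq nm bT.
have TE : as_words (T' ++ T) = as_words T' ++ as_words T by apply: map_cat.
split; first exact: leq_trans nm.
  rewrite TE -/(as_words _) -/(bounded _ _) bounded_cat tm bT' bTm !andbT.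
  by rewrite (leq_trans pN) // (leq_trans Nn).
move=> R r s x bR rN sN.
have bR' : bounded R n by apply: bounded_leq bR.
rewrite TE -!catA.
rewrite -(HT' (as_words T ++ R) p [:: l0]) ?(leq_trans _ Nn) //; last first.
  by rewrite bounded_cat bT.
have wE : word_val g ([:: l0] ++ v) = word_val g w.
  rewrite !word_val_cons mulgA; case: (l0) => i [];
    by rewrite /letter_val /= ?mulgV ?mulVg mul1g.
transitivity (reach (word_val g) (E ++ (p, w, q) :: R) r s x).
  by apply: reach_mem => e; rewrite !(inE, mem_cat) orbCA.
rewrite IH //; last by rewrite /= pN qN.
split; apply: reach_sim => p' w' q'; rewrite !(inE, mem_cat).
  case/or3P=> [H|/eqP[-> -> ->]|H].
  - by apply: reach_edge; rewrite inE mem_cat H orbT.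
  - by rewrite -wE; apply: reach_edge; rewrite mem_head.
  - by apply: reach_edge; rewrite inE mem_cat H !orbT.
case/or3P=> [/eqP[-> -> ->]|H|H].
- by rewrite wE; apply: reach_edge; rewrite !(inE, mem_cat) eqxx orbT.
- by apply: reach_edge; rewrite mem_cat H.
- by apply: reach_edge; rewrite mem_cat inE H !orbT.
Qed.

Definition fresh (k : nat) (E : edges k) : nat :=
  foldr (fun e m => (e.1.1 + e.2 + m).+1) 2 E.

Lemma fresh_gt1 k (E : edges k) : 1 < fresh E.
Proof. by elim: E => //= e E IH; rewrite leqW // (leq_trans IH) // leq_addl. Qed.

Lemma bounded_fresh k (E : edges k) : bounded E (fresh E).
Proof.
elim: E => //= -[[p w] q] E IH /=; rewrite !ltnS -addnA leq_addr /=.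
rewrite addnCA leq_addr /=; apply: bounded_leq IH.
by rewrite addnCA addnA leqW // leq_addl.
Qed.

Lemma ltn_count (T : Type) (a b : pred T) (s : seq T) :
  subpred a b -> has (predD b a) s -> count a s < count b s.
Proof.
move=> ab; elim: s => //= x s IH /orP[/andP[nax ->]|/IH H].
  by rewrite (negbTE nax) add0n add1n ltnS sub_count.
by rewrite -addnS leq_add //; case: (a x) (ab x) => // ->.
Qed.

(** * Backward search for words leading to given states *)

Section Labels.
Variable k : nat.
Implicit Types (E : edges k) (L : seq (nat * word k)).

Definition key L p : bool := has (fun z => z.1 == p) L.

Definition lab L p : word k := head [::] [seq z.2 | z <- L & z.1 == p].

(** One round of the search: the source of an edge into a labelled state receives a label. As [lab]
    reads the first entry, appending never changes an older label. *)
Definition lab_step E L :=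
  L ++ [seq (e.1.1, e.1.2 ++ lab L e.2) | e <- E & key L e.2].

Definition labs E L := iter (size E) (lab_step E) L.

Lemma lab_mem L p : key L p -> (p, lab L p) \in L.
Proof.
rewrite /key /lab; elim: L => //= -[q w] L IH /=.
by rewrite inE; case: eqP => [->|_ /IH->]; rewrite ?eqxx ?orbT.
Qed.

Lemma key_mem L p w : (p, w) \in L -> key L p.
Proof. by move=> pL; apply/hasP; exists (p, w) => /=. Qed.

Lemma key_step E L p : key L p -> key (lab_step E L) p.
Proof. by rewrite /key has_cat => ->. Qed.

Lemma key_step_edge E L p w q : (p, w, q) \in E -> key L q -> key (lab_step E L) p.
Proof.
move=> pE qL; apply: (@key_mem _ _ (w ++ lab L q)); rewrite mem_cat; apply/orP; right.
by apply/mapP; exists (p, w, q); rewrite // mem_filter qL.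
Qed.

Lemma labs_cat E L : exists L', labs E L = L ++ L'.
Proof.
rewrite /labs; elim: (size E) => [|n [L' IH]] /=; first by exists [::]; rewrite cats0.
by rewrite IH /lab_step -catA; eexists.
Qed.

Lemma labs_sound (K : groupType) (g : 'I_k -> K) E L p : key (labs E L) p ->
  exists q v y, [/\ (q, v) \in L, reach (word_val g) E q p y
    & word_val g (lab (labs E L) p) = y * word_val g v].
Proof.
move=> /lab_mem; move: (lab _ p) => w.
rewrite /labs; elim: (size E) p w => [|n IH] p w /=.
  by move=> pL; exists p, w, 1; split; rewrite ?mul1g //; apply: reach_refl.
rewrite mem_cat => /orP[/IH //|/mapP[[[p' w'] q]]].
rewrite mem_filter /= => /andP[/lab_mem /IH[q' [v [y [vL qy labE]]]] pE] [-> ->].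
exists q', v, (word_val g w' * y); split=> //; first exact: reach_step pE qy.
by rewrite word_val_cat labE mulgA.
Qed.

(* The number of edges whose source has no label decreases at each round,
   until the set of labelled states is closed. *)
Lemma labs_closed E L p w q : (p, w, q) \in E ->
  key (labs E L) q -> key (labs E L) p.
Proof.
pose miss L := count (fun e : nat * word k * nat => ~~ key L e.1.1) E.
pose closed L := forall p w q, (p, w, q) \in E -> key L q -> key L p.
have keyE M p' : closed M -> key (lab_step E M) p' -> key M p'.
  move=> cM; rewrite /key has_cat => /orP[//|/hasP[z /mapP[[[p1 w1] q1]]]].
  by rewrite mem_filter /= => /andP[q1M p1E] -> /eqP <-; apply: cM p1E q1M.
have closedS M : closed M -> closed (lab_step E M).
  by move=> cM p1 w1 q1 p1E q1M; apply/key_step/(cM _ _ _ p1E)/keyE.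
suff main n M : miss M <= n -> closed (iter n (lab_step E) M).
  by apply: main; apply: count_size.
elim: n M => [|n IH] M mM.
  move=> p1 w1 q1 p1E _; move: mM; rewrite leqNgt -has_count.
  by move/hasPn/(_ _ p1E) => /=; rewrite negbK.
have [cM|ncM] := pselect (closed M).
  by elim: n.+1 {IH mM} => //= m; apply: closedS.
rewrite iterSr; apply: IH; rewrite -ltnS; apply: leq_trans mM.
have [[p1 w1] [q1 [p1E q1M p1M]]] : 
    exists pw q, [/\ (pw, q) \in E, key M q & ~~ key M pw.1].
  apply: contra_notP ncM => H p1 w1 q1 p1E q1M; apply: contrapT => /negP p1M.
  by apply: H; exists (p1, w1), q1.
have sub : subpred (fun e : nat * word k * nat => ~~ key (lab_step E M) e.1.1)
                   (fun e => ~~ key M e.1.1).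
  by move=> e; apply: contra; apply: key_step.
have p1M' := key_step_edge p1E q1M.
by apply: ltn_count sub _; apply/hasP; exists (p1, w1, q1); rewrite //= p1M p1M'.
Qed.

Lemma labs_complete (K : groupType) (g : 'I_k -> K) E L p q x :
  key L q -> reach (word_val g) E q p x -> key (labs E L) p.
Proof.
move=> qL; elim=> [|{}p w r {}x pE _ IH]; last exact: labs_closed pE IH.
by have [L' ->] := labs_cat E L; rewrite /key has_cat -/(key _ _) qL.
Qed.

End Labels.

(** * Rational subsets of a factor *)

Lemma comp_FSA (X : Type) {eX : Enc X} (k : nat) (f h : X -> seq nat)
    (t : X -> seq (nat * letter k * nat)) :
  computable f -> computable h -> computable t ->
  computable (fun x => FSA (f x) (h x) (t x)).
Proof. by move=> cf ch ct; apply: (comp_pair_data _ cf (comp_pair ch ct)). Qed.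

Lemma comp_of_fsa (k : nat) : computable (@of_fsa k).
Proof.
have ci : computable (@fsa_init k).
  by exists (Assign (EHd Var)) => x; apply: exec_assign.
have cf : computable (@fsa_final k).
  by exists (Assign (EHd (ETl Var))) => x; apply: exec_assign.
have ct : computable (@fsa_trans k).
  by exists (Assign (ETl (ETl Var))) => x; apply: exec_assign.
rewrite /of_fsa; comp_tac.
Qed.

Lemma comp_word_inv (k : nat) (X : Type) {eX : Enc X} (f : X -> word k) :
  computable f -> computable (fun x => word_inv (f x)).
Proof. move=> cf; rewrite /word_inv; comp_tac. Qed.

Lemma comp_key (k : nat) (X : Type) {eX : Enc X}
    (L : X -> seq (nat * word k)) (p : X -> nat) :
  computable L -> computable p -> computable (fun x => key (L x) (p x)).
Proof. move=> cL cp; rewrite /key; comp_tac. Qed.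

Lemma comp_lab (k : nat) (X : Type) {eX : Enc X}
    (L : X -> seq (nat * word k)) (p : X -> nat) :
  computable L -> computable p -> computable (fun x => lab (L x) (p x)).
Proof. move=> cL cp; rewrite /lab; comp_tac. Qed.

Lemma comp_labs (k : nat) (X : Type) {eX : Enc X} (E : X -> edges k)
    (L : X -> seq (nat * word k)) :
  computable E -> computable L -> computable (fun x => labs (E x) (L x)).
Proof.
move=> cE cL; rewrite /labs /lab_step /edges; comp_tac.
- by apply: comp_lab; comp_tac.
- by apply: comp_key; comp_tac.
Qed.

Lemma comp_chain (k : nat) (X : Type) {eX : Enc X}
    (q n : X -> nat) (v : X -> word k) :
  computable q -> computable n -> computable v ->
  computable (fun x => chain (q x) (n x) (v x)).
Proof. by move=> cq cn cv; rewrite /chain; comp_tac. Qed.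

Lemma comp_to_fsa_edges (k : nat) (l0 : letter k) :
  computable (fun E : edges k => to_fsa_edges (fresh E) l0 E).
Proof.
rewrite /to_fsa_edges /fresh /edges; comp_tac.
all: try apply: comp_chain; comp_tac.
Qed.

(* Without generators no letter can replace an empty label, but then every
   label is empty and it only matters whether [1] is reachable. *)
Lemma exists_to_fsa (K : groupType) (k : nat) (g : 'I_k -> K) :
  exists F : edges k -> fsa k, computable F /\
    forall E x, fsa_set g (F E) x <-> reach (word_val g) E 1%N 0 x.
Proof.
case: k g => [|k] g.
  have w0 (w : word 0) : w = [::] by case: w => // -[[]].
  have val1 E p x : reach (word_val g) E 1%N p x -> x = 1.
    by elim=> // {}p w q {}x _ _ ->; rewrite (w0 w) word_val_nil mulg1.
  exists (fun E =>
    FSA [:: 0] (if key (labs E [:: (1%N, [::])]) 0 then [:: 0] else [::]) [::]).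
  split.
    apply: comp_FSA; comp_tac.
    by apply: comp_key; comp_tac; apply: comp_labs; comp_tac.
  move=> E x; rewrite fsa_setE /=; split.
    case=> p [q []]; rewrite inE => /eqP->; case: ifP => // k0.
    rewrite inE => /eqP-> H.
    have -> : x = 1 by case: H.
    case: (labs_sound g k0) => q' [v [y []]]; rewrite inE => /eqP[-> ->] qy _.
    by rewrite -(val1 _ _ _ qy).
  move=> H; exists 0, 0; rewrite (val1 _ _ _ H) (labs_complete _ H) ?inE //.
  by split=> //; rewrite ?inE //; apply: reach_refl.
pose l0 : letter k.+1 := (ord0, false).
exists (fun E => FSA [:: 0] [:: 1%N] (to_fsa_edges (fresh E) l0 E).2); split.
  by apply: comp_FSA; comp_tac; apply: comp_to_fsa_edges.
move=> E x; have [_ _ H] := to_fsa_edgesP g l0 (bounded_fresh E).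
have {H} := H [::] 1%N 0 x isT (fresh_gt1 E) (ltnW (fresh_gt1 E)).
rewrite !cats0 reach_as_words => ->; rewrite fsa_setE /=; split.
  by case=> p [q []]; rewrite !inE => /eqP-> /eqP->.
by move=> H; exists 0, 1%N.
Qed.

(** * Passing between a factor and its subgroup [A] *)

Section Factor.
Variables (A K : groupType) (a k : nat) (gA : 'I_a -> A) (gK : 'I_k -> K).
Hypotheses (hA : generates gA) (hK : generates gK).
Variable f : {multiplicative A -> K}.
Hypothesis finj : injective f.
Hypothesis hrat : decidable_rational_membership gK.
Hypothesis heff : effectively_closed_rational gK (range f).
Variable ms : seq (word k).

(** The submonoid generated by the values of [ms]; it will be the part of [M] in this factor. *)
Definition ms_monoid (y : K) : Prop :=
  exists2 ws : seq (word k), {subset ws <= ms} & y = word_val gK (flatten ws).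

Lemma exists_translation : exists tr : word a -> word k,
  computable tr /\ forall v, word_val gK (tr v) = f (word_val gA v).
Proof.
(* Choice selects one word per letter, and finitely many words form a table. *)
have [fw fwE] := choice (fun l => hK (f (letter_val gA l))).
exists (fun v => flatten (map fw v)); split.
  by comp_tac; apply: comp_letter; comp_tac.
elim=> [|l v IH] /=; first by rewrite !word_val_nil multf1.
by rewrite word_val_cat word_val_cons gmulfM IH fwE.
Qed.

Lemma exists_edges_test : exists tst : edges k -> word k -> bool,
  computable (fun t => tst t.1 t.2) /\
  forall E w, tst E w <-> reach (word_val gK) E 1%N 0 (word_val gK w).
Proof.
have [F [cF FE]] := exists_to_fsa gK.
exists (fun E w => `[< fsa_set gK (F E) (word_val gK w) >]); split.
  have [p Hp] := hrat.
  have ch : computable (fun u : fsa k * word k =>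
      `[< fsa_set gK u.1 (word_val gK u.2) >]).
    by exists p => u; apply: Hp.
  apply: (comp_comp ch (f := fun t : edges k * word k => (F t.1, t.2))).
  by comp_tac.
by move=> E w; rewrite -FE; split=> /asboolP.
Qed.

Lemma exists_is_one : exists is1 : word k -> bool,
  computable is1 /\ forall w, is1 w <-> word_val gK w = 1.
Proof.
have [tst [ct tE]] := exists_edges_test.
exists (tst [:: (0, [::], 1%N)]); split.
  by apply: (comp_ap2 (g := id) ct); comp_tac.
move=> w; rewrite tE; split=> [H|->].
  elim: H => // p v q x; rewrite inE => /eqP[_ -> _] _ ->.
  by rewrite word_val_nil mulg1.
by rewrite -(word_val_nil gK); apply: reach_edge; rewrite mem_head.
Qed.

(** As [A] is finitely generated, its image is rational: one loop at [1] for each letter. *)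
Lemma exists_range_test : exists inA : word k -> bool,
  computable inA /\ forall w, inA w <-> range f (word_val gK w).
Proof.
have [tr [_ trE]] := exists_translation.
have [tst [ct tE]] := exists_edges_test.
pose E := (0, [::], 1%N) :: [seq (1%N, tr [:: l], 1%N) | l <- enum {: 'I_a * bool}].
exists (tst E); split; first by apply: (comp_ap2 (g := id) ct); comp_tac.
move=> w; rewrite tE; split=> [|[x _ <-]].
  elim=> [|p v q x]; first by exists 1; rewrite ?multf1.
  rewrite inE => /orP[/eqP[_ -> _]|/mapP[l _ [_ -> _]]] _ [y _ <-].
    by exists y; rewrite // word_val_nil mul1g.
  by exists (letter_val gA l * y); rewrite // gmulfM trE word_val1.
have [v <-] := hA x; rewrite -[f _]mul1g -{1}(word_val_nil gK).
apply: (@reach_step _ _ _ _ _ _ _ 1%N); first by rewrite mem_head.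
elim: v => [|l v IH]; first by rewrite word_val_nil multf1; apply: reach_refl.
rewrite word_val_cons gmulfM -word_val1 -trE; apply: reach_step IH.
by rewrite inE map_f ?orbT // mem_enum.
Qed.

(** A word over the generators of [A] is found by exhaustive search, candidates being checked
    through the word problem. The test [inA] guards the loop, so it halts on words outside the image
    as well. *)
Lemma exists_to_subgroup : exists (inA : word k -> bool) (toA : word k -> word a),
  [/\ computable inA, computable toA, forall w, inA w <-> range f (word_val gK w)
    & forall w, inA w -> f (word_val gA (toA w)) = word_val gK w].
Proof.
have [tr [ctr trE]] := exists_translation.
have [is1 [cis1 is1E]] := exists_is_one.
have [inA [cinA inAE]] := exists_range_test.
pose ok (w : word k) (v : word a) := is1 (word_inv w ++ tr v).
have okE w v : ok w v <-> f (word_val gA v) = word_val gK w.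
  rewrite /ok is1E word_val_cat word_val_inv trE; split=> [/mulg1_eq|->].
    by rewrite invgK.
  by rewrite mulVg.
have cok : computable (fun t : word k * word a => ok t.1 t.2).
  by apply: (comp_comp cis1); comp_tac; apply: comp_word_inv; comp_tac.
(* After [n] rounds the list contains all words shorter than [n]. *)
pose next (t : word k * seq (word a)) :=
  (t.1, [::] :: flatten [seq [seq l :: v | l <- enum {: 'I_a * bool}] | v <- t.2]).
pose c (t : word k * seq (word a)) := inA t.1 && ~~ has (ok t.1) t.2.
have next1 n t : (iter n next t).1 = t.1 by elim: n.
have next2 t (v : word a) : v \in (iter (size v).+1 next t).2.
  elim: v => [|l v IH]; first by rewrite /= mem_head.
  rewrite [size _]/= iterS inE; apply/orP; right.
  by apply/flatten_mapP; exists v => //; apply: map_f; rewrite mem_enum.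
have halt t : exists n, ~~ c (iter n next t).
  rewrite /c; have [|nA] := boolP (inA t.1); last by exists 0; rewrite /= (negbTE nA).
  move/inAE=> [x _ xw]; have [v vx] := hA x.
  exists (size v).+1; rewrite negb_and negbK; apply/orP; right.
  apply/hasP; exists v; first exact: next2.
  by rewrite next1; apply/okE; rewrite vx.
pose run t := iter (ex_minn (halt t)) next t.
have crun : computable run.
  apply: (comp_while (c := c) (h := next)).
  - by rewrite /c; comp_tac.
  - by rewrite /next; comp_tac.
  - move=> t; rewrite /run; case: ex_minnP => n cn nmin; exists n; split=> // i ilt.
    by apply: contraTT ilt => /nmin; rewrite -leqNgt.
exists inA, (fun w => head [::] [seq v <- (run (w, [::])).2 | ok w v]); split=> //.
  by comp_tac.
move=> w wA; rewrite /run; case: ex_minnP => n + _.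
rewrite /c next1 /= wA /= negbK has_filter; move: (iter _ _ _).2 => l.
case E: [seq _ <- _ | _] => [//|v r] _ /=.
by apply/okE; have := mem_head v r; rewrite -E mem_filter => /andP[].
Qed.

Lemma range_mulr x y : range f y -> range f (x * y) <-> range f x.
Proof.
move=> [z _ <-]; split=> [[t _ tE]|[t _ <-]]; last by exists (t * z); rewrite ?gmulfM.
by exists (t / z); rewrite // gmulfM multfV tE mulgK.
Qed.

Section Pull.
Variables (inA : word k -> bool) (toA : word k -> word a).
Hypothesis inAE : forall w, inA w <-> range f (word_val gK w).
Hypothesis toAE : forall w, inA w -> f (word_val gA (toA w)) = word_val gK w.

(* The initial state is labelled [::], too, so that pulling an automaton back does
   not change the values of its paths from [0] to [1]. *)
Definition pull_labels (E : edges k) := labs E [:: (0, [::]); (1%N, [::])].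

Definition pull_label (E : edges k) (e : nat * word k * nat) : word k :=
  word_inv (lab (pull_labels E) e.1.1) ++ e.1.2 ++ lab (pull_labels E) e.2.

(* Conjugating an edge by words leading from its endpoints to the final state
   moves the label of any edge on a successful path into the subgroup. *)
Definition pull (E : edges k) : edges a :=
  [seq (e.1.1, toA (pull_label E e), e.2) | e <- E & inA (pull_label E e)].

(** With [x_ p] the value of the label of [p], a path from [p] to [1] of value [y] turns into one of
    value [(x_ p)^-1 * y]. Both [0] and [1] have the empty label, so accepted values are kept. *)
Lemma pullP E : (forall x, reach (word_val gK) E 1%N 0 x -> range f x) ->
  forall d, reach (word_val gA) (pull E) 1%N 0 d <->
    reach (word_val gK) E 1%N 0 (f d).
Proof.
move=> RA; set L := pull_labels E.
pose x_ p := word_val gK (lab L p).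
have [L' LE] := labs_cat E [:: (0, [::]); (1%N, [::] : word k)].
have x0 : x_ 0 = 1 by rewrite /x_ /L /pull_labels LE word_val_nil.
have x1 : x_ 1%N = 1 by rewrite /x_ /L /pull_labels LE word_val_nil.
have lblE p w q : word_val gK (pull_label E (p, w, q)) =
    (x_ p)^-1 * (word_val gK w * x_ q).
  by rewrite /pull_label !word_val_cat word_val_inv.
move=> d; split=> [H|].
  suff sound p e : reach (word_val gA) (pull E) 1%N p e ->
      reach (word_val gK) E 1%N p (x_ p * f e).
    by have := sound _ _ H; rewrite x0 mul1g.
  elim=> {H d e} [|{}p v q d]; first by rewrite x1 multf1 mulg1; apply: reach_refl.
  case/mapP=> -[[p' w] q']; rewrite mem_filter => /andP[wA pE] [-> -> ->] _ IH.
  rewrite gmulfM toAE // lblE -!mulgA mulVKg; exact: reach_step pE IH.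
(* The label of [p] leads to [1] or to [0]. In the second case the loop at [0] is followed by the
   path to [1] through [p], whose value lies in the image and can be divided off. *)
have good p y0 y : reach (word_val gK) E p 0 y0 -> reach (word_val gK) E 1%N p y ->
    range f (y0 * x_ p).
  move=> py0 py; have ky : key L p by apply: labs_complete py.
  have [q [v [z [qv qz xz]]]] := labs_sound gK ky.
  move: qv qz xz; rewrite !inE -/(x_ p) => /orP[]/eqP[-> ->] qz.
    rewrite word_val_nil mulg1 => ->.
    apply/(range_mulr _ (RA _ (reach_trans py0 py)))/RA.
    exact: reach_trans (reach_trans py0 qz) (reach_trans py0 py).
  by rewrite word_val_nil mulg1 => ->; apply/RA/(reach_trans py0).
move=> H; suff: forall p y, reach (word_val gK) E 1%N p y -> forall y0,
    reach (word_val gK) E p 0 y0 ->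
    exists2 d', f d' = (x_ p)^-1 * y & reach (word_val gA) (pull E) 1%N p d'.
  move/(_ _ _ H _ (reach_refl _ _ _))=> [d' + Hd'].
  by rewrite x0 invg1 mul1g => /finj <-.
move=> p y; elim=> [|{H}{}p w q {}y pE qy IH] y0 py0.
  by exists 1; [rewrite x1 multf1 invg1 mulg1|apply: reach_refl].
have qy0 := reach_trans py0 (reach_edge (word_val gK) pE).
have [d' d'E Hd'] := IH _ qy0.
(* The conjugated label is the quotient of two elements of the image, obtained from [good] at the
   two endpoints. *)
have wA : inA (pull_label E (p, w, q)).
  apply/inAE; rewrite lblE.
  have [u _ uE] := good _ _ _ qy0 qy.
  have [t _ tE] := good _ _ _ py0 (reach_step pE qy).
  exists (t^-1 * u) => //; rewrite gmulfM multfV uE tE invgM.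
  by rewrite -!mulgA mulKg.
exists (word_val gA (toA (pull_label E (p, w, q))) * d').
  by rewrite gmulfM toAE // lblE d'E -!mulgA mulVKg.
apply: reach_step Hd'; apply/mapP; exists (p, w, q) => //.
by rewrite mem_filter wA.
Qed.

End Pull.

(** An automaton for [M^-1 S u]: loops at [0] read inverses of monoid generators, then [S] runs on
    shifted states from [2] to [3], and the last edge reads [u]. *)
Definition quot (tr : word a -> word k) (S : edges a) (u : word k) : edges k :=
  [seq (0, word_inv m, 0) | m <- ms] ++ (0, [::], 2) ::
  [seq (e.1.1.+2, tr e.1.2, e.2.+2) | e <- S] ++ [:: (3, u, 1%N)].

Lemma quotP tr S u x : (forall v, word_val gK (tr v) = f (word_val gA v)) ->
  reach (word_val gK) (quot tr S u) 1%N 0 x <->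
  exists m d, [/\ ms_monoid m, reach (word_val gA) S 1%N 0 d &
    m * x = f d * word_val gK u].
Proof.
move=> trE; split.
  (* The values of paths to [1], by starting state. *)
  pose Q s x := match s with
    | 0 => exists m d, [/\ ms_monoid m, reach (word_val gA) S 1%N 0 d
                        & m * x = f d * word_val gK u]
    | 1 => x = 1
    | p.+2 => exists2 d, reach (word_val gA) S 1%N p d & x = f d * word_val gK u
    end.
  suff main s y : reach (word_val gK) (quot tr S u) 1%N s y -> Q s y by apply: main.
  elim=> {x s y} // p w q x; rewrite mem_cat inE mem_cat inE.
  case/or4P=> [/mapP[m mms [-> -> ->]]|/eqP[-> -> ->]|/mapP[[[p' v] q'] pS
    [-> -> ->]]|/eqP[-> -> ->]] _ /=.
  - case=> _ [d [[ws wsP ->] Sd xE]].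
    exists (word_val gK (flatten (rcons ws m))), d; split=> //.
      by exists (rcons ws m) => // v; rewrite mem_rcons inE => /orP[/eqP->|/wsP].
    by rewrite -cats1 flatten_cat /= cats0 word_val_cat word_val_inv -mulgA mulVKg.
  - case=> d Sd ->; exists 1, d; split=> //; last by rewrite word_val_nil !mul1g.
    by exists [::]; rewrite // word_val_nil.
  - case=> d Sd ->; exists (word_val gA v * d); first exact: reach_step pS Sd.
    by rewrite trE gmulfM mulgA.
  - by move=> ->; exists 1; [apply: reach_refl|rewrite multf1 mul1g mulg1].
case=> _ [d [[ws wsP ->] Sd xE]].
have -> : x = (word_val gK (flatten ws))^-1 * (f d * word_val gK u).
  by rewrite -xE mulKg.
have sub1 : (0, [::], 2) \in quot tr S u by rewrite mem_cat mem_head orbT.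
have sub2 : (3, u, 1%N) \in quot tr S u.
  by rewrite mem_cat inE mem_cat mem_head !orbT.
(* Inversion reverses the product, so the inverse of the last generator is read first. *)
elim/last_ind: ws wsP {xE} => [|ws m IH] wsP.
  rewrite word_val_nil invg1 -{1}(word_val_nil gK); apply: reach_step sub1 _.
  apply: (reach_trans (q := 3)); last exact: reach_edge.
  suff shift p e : reach (word_val gA) S 1%N p e ->
    reach (word_val gK) (quot tr S u) 3 p.+2 (f e) by apply: shift.
  elim=> [|{}p v q {}e pS _ He]; first by rewrite multf1; apply: reach_refl.
  rewrite gmulfM -trE; apply: reach_step He; rewrite mem_cat inE mem_cat.
  by rewrite (map_f (fun e => (e.1.1.+2, tr e.1.2, e.2.+2)) pS) !orbT.
rewrite -cats1 flatten_cat /= cats0 word_val_cat invgM -mulgA -word_val_inv.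
apply: (@reach_step _ _ _ _ _ _ _ 0).
  by rewrite mem_cat map_f // wsP // mem_rcons mem_head.
by apply: IH => v vws; rewrite wsP // mem_rcons inE vws orbT.
Qed.

Lemma reach_translate tr (S : edges a) r p x :
  (forall v, word_val gK (tr v) = f (word_val gA v)) ->
  reach (word_val gK) [seq (e.1.1, tr e.1.2, e.2) | e <- S] r p x <->
  exists2 d, f d = x & reach (word_val gA) S r p d.
Proof.
move=> trE; split=> [|[d <-]].
  elim=> [|{}p w q {}x]; first by exists 1; [rewrite multf1|apply: reach_refl].
  case/mapP=> -[[p' v] q'] pS [-> -> ->] _ [d <- rd].
  exists (word_val gA v * d); last exact: reach_step pS rd.
  by rewrite gmulfM trE.
elim=> [|{}p v q {}d pS _ IH]; first by rewrite multf1; apply: reach_refl.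
by rewrite gmulfM -trE; apply: reach_step IH; apply/mapP; exists (p, v, q).
Qed.

(** All that the decision procedure uses about a factor. [step] computes the next set [S_i]: it
    intersects [quot] with the image of [A] and pulls the result back. *)
Lemma factor_algorithms :
  exists (tr : word a -> word k) (inA : word k -> bool) (toA : word k -> word a)
    (step : edges a -> word k -> edges a) (acc : edges a -> bool),
  [/\ computable tr, computable inA, computable toA,
      computable (fun t => step t.1 t.2) & computable acc] /\
  [/\ forall v, word_val gK (tr v) = f (word_val gA v),
      forall w, inA w <-> range f (word_val gK w),
      forall w, inA w -> f (word_val gA (toA w)) = word_val gK w,
      forall S u d, reach (word_val gA) (step S u) 1%N 0 d <->
        exists m e, [/\ ms_monoid m, reach (word_val gA) S 1%N 0 e
                     & m * f d = f e * word_val gK u]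
    & forall S, acc S <-> reach (word_val gA) S 1%N 0 1].
Proof.
have [tr [ctr trE]] := exists_translation.
have [inA [toA [cinA ctoA inAE toAE]]] := exists_to_subgroup.
have [F [cF FE]] := exists_to_fsa gK.
have [tst [ctst tstE]] := exists_edges_test.
have [_ [p Hp]] := heff.
(* Choice turns the output automata of [p] into a function, which [p] then computes. *)
have [H HE] := choice Hp.
have cH : computable H by exists p => D; case: (HE D).
exists tr, inA, toA, (fun S u => pull inA toA (of_fsa (H (F (quot tr S u))))),
  (fun S => tst [seq (e.1.1, tr e.1.2, e.2) | e <- S] [::]).
split; split=> //.
- have cE : computable (fun t : edges a * word k => of_fsa (H (F (quot tr t.1 t.2)))).
    apply: (comp_comp (@comp_of_fsa k)); apply: (comp_comp cH); apply: (comp_comp cF).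
    by rewrite /quot /edges; comp_tac.
  have cpull : computable (pull inA toA).
    have cl (X : Type) (eX : Enc X) (E : X -> edges k) (e : X -> nat * word k * nat) :
        computable E -> computable e -> computable (fun x => pull_label (E x) (e x)).
      move=> cE0 ce; rewrite /pull_label /pull_labels; comp_tac.
        by apply: comp_word_inv; apply: comp_lab; comp_tac;
          apply: comp_labs; comp_tac.
      by apply: comp_lab; comp_tac; apply: comp_labs; comp_tac.
    by rewrite /pull /edges; comp_tac; apply: cl; comp_tac.
  exact: comp_comp cpull cE.
- apply: (comp_ap2 ctst) (comp_const _); rewrite /edges.
  by apply: (comp_map (h := fun _ e => _) (l := id)); comp_tac.
- move=> S u d; rewrite pullP //; last first.
    by move=> x /of_fsaP; case: (HE (F (quot tr S u))) => _ -> [].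
  rewrite of_fsaP; case: (HE (F (quot tr S u))) => _ ->.
  rewrite -quotP // -FE; split=> [[] //|Hd]; split=> //.
- move=> S; rewrite tstE word_val_nil (reach_translate _ _ _ _ trE).
  split=> [[d d1 Sd]|Sd]; last by exists 1; rewrite ?multf1.
  suff <- : d = 1 by [].
  by apply: finj; rewrite d1 multf1.
Qed.

End Factor.

(** * The decision procedure *)

Lemma submonoid_gen_ind (K : groupType) (X N : set K) :
  is_submonoid N -> X `<=` N -> submonoid_gen X `<=` N.
Proof. by move=> hN XN z; apply; split. Qed.

(** The generators of the intersection are written as words over [gK]; injectivity of [i] brings
    products of them back to [K]. *)
Lemma fg_factor_monoid (K G : groupType) (k : nat) (gK : 'I_k -> K)
    (i : {multiplicative K -> G}) (M : set G) :
  generates gK -> injective i -> is_submonoid M -> fg_monoid (M `&` range i) ->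
  exists ms : seq (word k), forall y, M (i y) <-> ms_monoid gK ms y.
Proof.
move=> hK iinj [M1 MM] [X [/finite_seqP[s ->] MX]].
have sub x : x \in s -> (M `&` range i) x.
  by move=> xs; rewrite MX => N [_]; apply.
have ex x : exists w : word k, x \in s -> i (word_val gK w) = x.
  have [/sub[_ [y _ <-]]|_] := boolP (x \in s); last by exists [::].
  by have [w <-] := hK y; exists w.
have [h hE] := choice ex.
exists (map h s) => y; split=> [My|[ws wsP ->]].
  pose N := [set z | exists2 ws : seq (word k), {subset ws <= map h s} &
                       z = i (word_val gK (flatten ws))].
  have : N (i y).
    have : (M `&` range i) (i y) by split=> //; exists y.
    rewrite MX; apply: submonoid_gen_ind; last first.
      move=> z /= zs; exists [:: h z]; last by rewrite /= cats0 hE.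
      by move=> v; rewrite inE => /eqP->; apply: map_f.
    split; first by exists [::]; rewrite // word_val_nil multf1.
    move=> _ _ [us usP ->] [vs vsP ->]; exists (us ++ vs).
      by move=> v; rewrite mem_cat => /orP[/usP|/vsP].
    by rewrite flatten_cat word_val_cat gmulfM.
  by case=> ws wsP /iinj ->; exists ws.
elim: ws wsP => [|w ws IH] wsP; first by rewrite /= word_val_nil multf1.
rewrite /= word_val_cat gmulfM; apply: MM.
  have /mapP[x xs ->] := wsP w (mem_head _ _).
  by rewrite hE //; have [] := sub _ xs.
by apply: IH => v vws; apply: wsP; rewrite inE vws orbT.
Qed.

(** * Membership in [M] as a chain of equations *)

Section Main.
Variables (A B C G : groupType) (a b c : nat).
Variables (gA : 'I_a -> A) (gB : 'I_b -> B) (gC : 'I_c -> C).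
Hypotheses (hA : generates gA) (hB : generates gB) (hC : generates gC).
Variables (f : {multiplicative A -> B}) (g : {multiplicative A -> C}).
Variables (iB : {multiplicative B -> G}) (iC : {multiplicative C -> G}).
Hypothesis hG : is_amalgam f g iB iC.
Variable M : set G.
Hypothesis hM : is_submonoid M.

Let finj : injective f. Proof. by case: hG. Qed.
Let ginj : injective g. Proof. by case: hG. Qed.
Let fgE x : iB (f x) = iC (g x). Proof. by case: hG => _ _ [-> _]. Qed.

Local Notation spell := (spell iB iC).
Local Notation syl_val := (syl_val iB iC).

Definition all_in (s : seq (B + C)) : Prop :=
  foldr (fun y P => M (syl_val y) /\ P) True s.

(** The elements [e_i] that link the syllables of [s] to elements of [M], with [e_0 = d] and
    [e_n = d']. *)
Fixpoint mchain (d : A) (s : seq (B + C)) (d' : A) : Prop :=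
  match s with
  | [::] => d = d'
  | inl k :: s' => exists m e, [/\ M (iB m), m * f e = f d * k & mchain e s' d']
  | inr k :: s' => exists m e, [/\ M (iC m), m * g e = g d * k & mchain e s' d']
  end.

(** The links telescope, and [m] is the product of their elements of [M]. *)
Lemma mchain_sound d s d' : mchain d s d' ->
  exists2 m, M m & m * iB (f d') = iB (f d) * spell s.
Proof.
have [M1 MM] := hM.
elim: s d => [|[k|k] s IH] d /=; first by move=> ->; exists 1; rewrite ?mul1g ?mulg1.
  move=> [m [e [Mm E /IH[m' Mm' E']]]]; exists (iB m * m'); first exact: MM.
  by rewrite -mulgA E' !mulgA -!gmulfM E.
move=> [m [e [Mm E /IH[m' Mm' E']]]]; exists (iC m * m'); first exact: MM.
by rewrite -mulgA E' !mulgA !fgE -!gmulfM E.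
Qed.

Lemma mchain_complete d s r : interp f g d s r -> all_in r -> mchain d s 1.
Proof.
elim=> {d s r} [|d d' k h s r E _ IH|d d' k h s r E _ IH] //= [Mh /IH H].
  by exists h, d'.
by exists h, d'.
Qed.

(** * Computing reduced forms and the sets [S_i] *)

Section Algorithm.
Variables (trB : word a -> word b) (inAB : word b -> bool) (toAB : word b -> word a).
Variables (trC : word a -> word c) (inAC : word c -> bool) (toAC : word c -> word a).
Hypotheses (trBE : forall v, word_val gB (trB v) = f (word_val gA v))
  (inABE : forall w, inAB w <-> range f (word_val gB w))
  (toABE : forall w, inAB w -> f (word_val gA (toAB w)) = word_val gB w).
Hypotheses (trCE : forall v, word_val gC (trC v) = g (word_val gA v))
  (inACE : forall w, inAC w <-> range g (word_val gC w))
  (toACE : forall w, inAC w -> g (word_val gA (toAC w)) = word_val gC w).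

Local Notation syllable := (word b + word c)%type.
(* The state [(v, [:: y1; ...; yn])] stands for [v y1 ... yn] with [v] in [A]. *)
Local Notation state := (word a * seq syllable)%type.

Definition syl (y : syllable) : B + C :=
  match y with inl w => inl (word_val gB w) | inr w => inr (word_val gC w) end.

Definition state_val (t : state) : G :=
  iB (f (word_val gA t.1)) * spell (map syl t.2).

(** The empty word stands in for a first syllable outside [B], so that [mull] needs no case
    distinction when merging. *)
Definition headl (s : seq syllable) : word b := if s is inl w :: _ then w else [::].
Definition restl (s : seq syllable) := if s is inl _ :: s' then s' else s.
Definition headr (s : seq syllable) : word c := if s is inr w :: _ then w else [::].
Definition restr (s : seq syllable) := if s is inr _ :: s' then s' else s.

Definition mull (u : word b) (t : state) : state :=
  let y := u ++ trB t.1 ++ headl t.2 in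
  if inAB y then (toAB y, restl t.2) else ([::], inl y :: restl t.2).

Definition mulr (u : word c) (t : state) : state :=
  let y := u ++ trC t.1 ++ headr t.2 in
  if inAC y then (toAC y, restr t.2) else ([::], inr y :: restr t.2).

Definition good (t : state) : Prop :=
  M (iB (f (word_val gA t.1))) /\ all_in (map syl t.2).

Lemma restlE s : iB (word_val gB (headl s)) * spell (map syl (restl s)) =
  spell (map syl s).
Proof. by case: s => [|[w|w] s] //=; rewrite word_val_nil multf1 mul1g. Qed.

Lemma restrE s : iC (word_val gC (headr s)) * spell (map syl (restr s)) =
  spell (map syl s).
Proof. by case: s => [|[w|w] s] //=; rewrite word_val_nil multf1 mul1g. Qed.

Lemma mull_val u t : state_val (mull u t) = iB (word_val gB u) * state_val t.
Proof.
have -> : iB (word_val gB u) * state_val t =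
    iB (word_val gB (u ++ trB t.1 ++ headl t.2)) * spell (map syl (restl t.2)).
  by rewrite /state_val -[in LHS]restlE !word_val_cat !gmulfM trBE !mulgA.
rewrite /mull /state_val; case: ifP => [/toABE /= ->|_ /=] //.
by rewrite word_val_nil !multf1 mul1g.
Qed.

Lemma mulr_val u t : state_val (mulr u t) = iC (word_val gC u) * state_val t.
Proof.
have -> : iC (word_val gC u) * state_val t =
    iC (word_val gC (u ++ trC t.1 ++ headr t.2)) * spell (map syl (restr t.2)).
  by rewrite /state_val fgE -[in LHS]restrE !word_val_cat !gmulfM trCE !mulgA.
rewrite /mulr /state_val fgE; case: ifP => [/toACE /= ->|_ /=] //.
by rewrite word_val_nil !multf1 mul1g.
Qed.

Lemma mull_reduced u t : reduced f g (map syl t.2) ->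
  reduced f g (map syl (mull u t).2).
Proof.
move=> rt; have [sr rr] : ~~ starts (@getl B C) (map syl (restl t.2)) /\
    reduced f g (map syl (restl t.2)).
  by case: t rt => v [|[w|w] s] //= [].
rewrite /mull; case: ifP => //= yA; split=> //.
by move/inABE; rewrite yA.
Qed.

Lemma mulr_reduced u t : reduced f g (map syl t.2) ->
  reduced f g (map syl (mulr u t).2).
Proof.
move=> rt; have [sr rr] : ~~ starts (@getr B C) (map syl (restr t.2)) /\
    reduced f g (map syl (restr t.2)).
  by case: t rt => v [|[w|w] s] //= [].
rewrite /mulr; case: ifP => //= yA; split=> //.
by move/inACE; rewrite yA.
Qed.

(** Merging only multiplies elements of [M], and a product absorbed into [A] is still in [M]. *)
Lemma mull_good u t : M (iB (word_val gB u)) -> good t -> good (mull u t).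
Proof.
have [M1 MM] := hM => Mu [Mv Ms].
have [My Mr] : M (iB (word_val gB (u ++ trB t.1 ++ headl t.2))) /\
    all_in (map syl (restl t.2)).
  rewrite !word_val_cat !gmulfM trBE.
  split; last by case: t Ms {Mv} => v [|[w|w] s] //= [].
  apply: (MM _ _ Mu); apply: (MM _ _ Mv).
  by case: t Ms {Mv} => v [|[w|w] s] /=; rewrite ?word_val_nil ?multf1 // => -[].
rewrite /mull; case: ifP => [/toABE yE|_]; split=> //=; first by rewrite yE.
by rewrite word_val_nil !multf1.
Qed.

Lemma mulr_good u t : M (iC (word_val gC u)) -> good t -> good (mulr u t).
Proof.
have [M1 MM] := hM => Mu [Mv Ms].
have [My Mr] : M (iC (word_val gC (u ++ trC t.1 ++ headr t.2))) /\
    all_in (map syl (restr t.2)).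
  rewrite !word_val_cat !gmulfM trCE -fgE.
  split; last by case: t Ms {Mv} => v [|[w|w] s] //= [].
  apply: (MM _ _ Mu); apply: (MM _ _ Mv).
  by case: t Ms {Mv} => v [|[w|w] s] /=; rewrite ?word_val_nil ?multf1 // => -[].
rewrite /mulr; case: ifP => [/toACE yE|_]; split=> //=; first by rewrite fgE yE.
by rewrite word_val_nil !multf1.
Qed.

(** A reduced product of elements of [M] arises by multiplying elements of the two factors onto a
    state one at a time, with [mull] and [mulr]. *)
Lemma good_cover x : M = submonoid_gen ((M `&` range iB) `|` (M `&` range iC)) ->
  M x -> exists t, [/\ good t, reduced f g (map syl t.2) & state_val t = x].
Proof.
(* Allowing an arbitrary good reduced state on the right makes [N] a submonoid, so only the
   generators remain to be treated. *)
move=> Mgen Mx; pose N := [set z | forall t, good t -> reduced f g (map syl t.2) ->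
  exists t', [/\ good t', reduced f g (map syl t'.2) &
    state_val t' = z * state_val t]].
have /(_ ([::], [::]))[] : N x.
- move: Mx; rewrite Mgen; apply: submonoid_gen_ind.
    split=> [t gt rt|y z Ny Nz t gt rt]; first by exists t; rewrite mul1g.
    have [t1 [gt1 rt1 E1]] := Nz t gt rt; have [t2 [gt2 rt2 E2]] := Ny t1 gt1 rt1.
    by exists t2; rewrite E2 E1 mulgA.
  move=> z [] [Mz [y _ yz]] t gt rt; rewrite -yz in Mz *.
    have [u uy] := hB y; rewrite -uy in Mz *.
    by exists (mull u t); rewrite mull_val; split;
      [apply: mull_good|apply: mull_reduced|].
  have [u uy] := hC y; rewrite -uy in Mz *.
  by exists (mulr u t); rewrite mulr_val; split;
    [apply: mulr_good|apply: mulr_reduced|].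
- by split=> //=; rewrite word_val_nil !multf1; case: hM.
- by [].
move=> t [gt rt tE]; exists t; split=> //.
by rewrite tE /state_val /= word_val_nil !multf1 !mulg1.
Qed.

Definition split_letter (l : letter (b + c)) : letter b + letter c :=
  match split l.1 with inl i => inl (i, l.2) | inr j => inr (j, l.2) end.

Definition normalize (w : word (b + c)) : state :=
  foldr (fun l t => match split_letter l with
                    | inl x => mull [:: x] t
                    | inr x => mulr [:: x] t
                    end) ([::], [::]) w.

Lemma normalize_val w : state_val (normalize w) = word_val (union_gens gB gC iB iC) w.
Proof.
elim: w => [|[i s] w IH].
  by rewrite /state_val /= !word_val_nil !multf1 mulg1.
rewrite word_val_cons -IH [normalize _]/= /split_letter /letter_val /union_gens /=.
by case: (split i) => j /=; rewrite (mull_val, mulr_val) word_val1 /letter_val /=;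
  case: s; rewrite // multfV.
Qed.

Lemma normalize_reduced w : reduced f g (map syl (normalize w).2).
Proof.
elim: w => //= l w IH; case: (split_letter l) => x.
  exact: mull_reduced.
exact: mulr_reduced.
Qed.

Variables (stepB : edges a -> word b -> edges a)
  (stepC : edges a -> word c -> edges a).
Local Notation accepts S d := (reach (word_val gA) S 1%N 0 d).
Hypotheses
  (stepBE : forall S u d, accepts (stepB S u) d <->
     exists m e, [/\ M (iB m), accepts S e & m * f d = f e * word_val gB u])
  (stepCE : forall S u d, accepts (stepC S u) d <->
     exists m e, [/\ M (iC m), accepts S e & m * g d = g e * word_val gC u]).

(** The single empty edge denotes the set of [1] alone. The first step, with the [A]-part read in
    [B], yields [S_0], and every syllable adds one step. *)
Definition run (t : state) : edges a :=
  foldl (fun S y => match y with inl u => stepB S u | inr u => stepC S u end)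
    (stepB [:: (0, [::], 1%N)] (trB t.1)) t.2.

Lemma runP t d : accepts (run t) d <->
  exists m e, [/\ M (iB m), m * f e = f (word_val gA t.1) & mchain e (map syl t.2) d].
Proof.
have one e : accepts [:: (0, [::], 1%N)] e <-> e = 1.
  split=> [H|->]; last by rewrite -(word_val_nil gA); apply: reach_edge;
    rewrite mem_head.
  elim: H => // p v q x; rewrite inE => /eqP[_ -> _] _ ->.
  by rewrite word_val_nil mulg1.
have start e : accepts (stepB [:: (0, [::], 1%N)] (trB t.1)) e <->
    exists2 m, M (iB m) & m * f e = f (word_val gA t.1).
  rewrite stepBE trBE; split=> [[m [d' [Mm /one-> E]]]|[m Mm E]].
    by exists m; rewrite // E multf1 mul1g.
  by exists m, 1; rewrite multf1 mul1g; split=> //; apply/one.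
suff fold S s : accepts (foldl (fun S y => match y with
      inl u => stepB S u | inr u => stepC S u end) S s) d <->
    exists2 e, accepts S e & mchain e (map syl s) d.
  rewrite /run fold; split=> [[e /start[m Mm E] ce]|[m [e [Mm E ce]]]].
    by exists m, e.
  by exists e => //; apply/start; exists m.
elim: s S => [|[u|u] s IH] S /=.
- by split=> [Sd|[e Se <-]] //; exists d.
- rewrite IH; split=> [[e /stepBE[m [e' [Mm Se' E]]] ce]|[e' Se' [m [e [Mm E ce]]]]].
    by exists e' => //; exists m, e.
  by exists e => //; apply/stepBE; exists m, e'.
- rewrite IH; split=> [[e /stepCE[m [e' [Mm Se' E]]] ce]|[e' Se' [m [e [Mm E ce]]]]].
    by exists e' => //; exists m, e.
  by exists e => //; apply/stepCE; exists m, e'.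
Qed.

(** One direction telescopes; the other compares the reduced form of the input with a reduced
    product of elements of [M] by the normal form theorem. *)
Lemma run_membership w : M = submonoid_gen ((M `&` range iB) `|` (M `&` range iC)) ->
  accepts (run (normalize w)) 1 <-> M (word_val (union_gens gB gC iB iC) w).
Proof.
have [M1 MM] := hM; move=> Mgen; rewrite runP -normalize_val; set t := normalize w.
split.
  move=> [m [e [Mm E /mchain_sound[m' Mm']]]]; rewrite !multf1 mulg1 => m'E.
  by rewrite /state_val -E gmulfM -mulgA -m'E; apply: MM.
case/(good_cover Mgen)=> r [[Mr Ms] rr E].
(* The [A]-part of the product in [M] serves as [m_0], which determines [e_0]. *)
exists (f (word_val gA r.1)), ((word_val gA r.1)^-1 * word_val gA t.1).
split=> //; first by rewrite -gmulfM mulVKg.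
apply: mchain_complete Ms; apply: (amalgam_interp hG) => //.
exact: normalize_reduced.
Qed.

Lemma comp_normalize_run : computable trB -> computable inAB -> computable toAB ->
  computable trC -> computable inAC -> computable toAC ->
  computable (fun t => stepB t.1 t.2) -> computable (fun t => stepC t.1 t.2) ->
  computable (fun w => run (normalize w)).
Proof.
move=> ctrB cinB ctoB ctrC cinC ctoC cstB cstC.
have chl (X : Type) (eX : Enc X) (s : X -> seq syllable) :
    computable s -> computable (fun x => headl (s x)).
  move=> cs; rewrite /headl.
  apply: (comp_seq_case (g := fun _ y _ => if y is inl w then w else [::])); comp_tac.
  by apply: (comp_sum_case (f := fun _ w => w)); comp_tac.
have chr (X : Type) (eX : Enc X) (s : X -> seq syllable) :
    computable s -> computable (fun x => headr (s x)).
  move=> cs; rewrite /headr.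
  apply: (comp_seq_case (g := fun _ y _ => if y is inr w then w else [::])); comp_tac.
  by apply: (comp_sum_case (g := fun _ w => w)); comp_tac.
have crl (X : Type) (eX : Enc X) (s : X -> seq syllable) :
    computable s -> computable (fun x => restl (s x)).
  move=> cs; rewrite /restl.
  apply: (comp_seq_case (f := s)
    (g := fun x y r => if y is inl w then r else s x)); comp_tac.
  by apply: (comp_sum_case (f := fun t _ => t.2) (g := fun t _ => s t.1.1)); comp_tac.
have crr (X : Type) (eX : Enc X) (s : X -> seq syllable) :
    computable s -> computable (fun x => restr (s x)).
  move=> cs; rewrite /restr.
  apply: (comp_seq_case (f := s)
    (g := fun x y r => if y is inr w then r else s x)); comp_tac.
  by apply: (comp_sum_case (f := fun t _ => s t.1.1) (g := fun t _ => t.2)); comp_tac.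
have cml : computable (fun t : word b * state => mull t.1 t.2).
  rewrite /mull; comp_tac; try apply: chl; try apply: crl; comp_tac.
have cmr : computable (fun t : word c * state => mulr t.1 t.2).
  rewrite /mulr; comp_tac; try apply: chr; try apply: crr; comp_tac.
have cnorm : computable normalize.
  apply: (comp_foldr (h := fun _ l t => match split_letter l with
                    | inl x => mull [:: x] t
                    | inr x => mulr [:: x] t
                    end) (l := id)); comp_tac.
  apply: (comp_sum_case (f := fun t x => mull [:: x] t.2)
    (g := fun t x => mulr [:: x] t.2)).
  - by apply: (comp_letter (k := b + c)); comp_tac.
  - by apply: (comp_ap2 cml); comp_tac.
  - by apply: (comp_ap2 cmr); comp_tac.
have crun : computable run.
  rewrite /run.
  apply: (comp_foldl (h := fun _ S y =>
    match y with inl u => stepB S u | inr u => stepC S u end)); comp_tac.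
  by apply: (comp_sum_case (f := fun t u => stepB t.1.2 u)
    (g := fun t u => stepC t.1.2 u)); comp_tac.
exact: comp_comp crun cnorm.
Qed.

End Algorithm.
End Main.

Theorem theoremB
    (A B C G : groupType) (a b c : nat)
    (gA : 'I_a -> A) (gB : 'I_b -> B) (gC : 'I_c -> C)
    (hA : generates gA) (hB : generates gB) (hC : generates gC)
    (f : {multiplicative A -> B}) (g : {multiplicative A -> C})
    (iB : {multiplicative B -> G}) (iC : {multiplicative C -> G})
    (hG : is_amalgam f g iB iC)
    (M : set G) (hM : is_submonoid M)
    (hMB : fg_monoid (M `&` range iB))
    (hMC : fg_monoid (M `&` range iC))
    (hMgen : M = submonoid_gen ((M `&` range iB) `|` (M `&` range iC)))
    (hratB : decidable_rational_membership gB)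
    (hratC : decidable_rational_membership gC)
    (hAB : effectively_closed_rational gB (range f))
    (hAC : effectively_closed_rational gC (range g)) :
  decidable_membership (union_gens gB gC iB iC) M.
Proof.
have [finj ginj _] := hG.
have [mB mBE] := fg_factor_monoid hB (amalgam_inj_l hG) hM hMB.
have [mC mCE] := fg_factor_monoid hC (amalgam_inj_r hG) hM hMC.
have [trB [inB [toB [stB [acB [[c1 c2 c3 c4 cac] [e1 e2 e3 e4 acE]]]]]]] :=
  factor_algorithms hA hB finj hratB hAB mB.
have [trC [inC [toC [stC [_ [[d1 d2 d3 d4 _] [h1 h2 h3 h4 _]]]]]]] :=
  factor_algorithms hA hC ginj hratC hAC mC.
(* The final test for [1] in [S_n] is carried out in [B]. *)
have [p Hp] := comp_comp cac (comp_normalize_run c1 c2 c3 d1 d2 d3 c4 d4).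
exists p => w; move: (Hp w); congr exec; congr enc_bool.
have stBE S u d : reach (word_val gA) (stB S u) 1%N 0 d <->
    exists m e, [/\ M (iB m), reach (word_val gA) S 1%N 0 e &
      m * f d = f e * word_val gB u].
  by rewrite e4; split=> -[m [e [/mBE ? ? ?]]]; exists m, e.
have stCE S u d : reach (word_val gA) (stC S u) 1%N 0 d <->
    exists m e, [/\ M (iC m), reach (word_val gA) S 1%N 0 e &
      m * g d = g e * word_val gC u].
  by rewrite h4; split=> -[m [e [/mCE ? ? ?]]]; exists m, e.
have runE := run_membership hB hC hG hM e1 e2 e3 h1 h2 h3 stBE stCE w hMgen.
by apply/idP/asboolP => [/acE/runE|/runE/acE].
Qed.
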